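(* Let $t_0\in\mathbb{R}$, let $\ell_0,\ell_1,f\in V$ be such that $\ell_0-\ell_1\in\mathcal{P}^+$, suppose $f(0)(t)=0$ for a.e. $t\le t_0$, and let there exist $\kappa>0$ such that: (i) $f(v)(t)\ge 0$ for a.e. $t\le t_0$ and every $v\in C_0(\mathbb{R};[0,\kappa])$; (ii) $0\le f(v)(t)\le q(t,\|v\|)$ for a.e. $t\ge t_0$ and every $v\in C_0(\mathbb{R};\mathbb{R}_+)$ with $v(t)\le\kappa$ for $t\le t_0$, where $q\in K_{loc}([t_0,+\infty)\times\mathbb{R}_+;\mathbb{R}_+)$ is nondecreasing in the second argument and satisfies $\lim_{x\to+\infty}\frac1x\int_{t_0}^b q(s,x)\,ds=0$ for every $b>t_0$. Then, for every $c\in[0,\kappa]$, there exists a global solution $u$ to $u'(t)=\ell_0(u)(t)-\ell_1(u)(t)+f(u)(t)$, $u(t_0)=c$, satisfying $0\le u(t)\le\kappa$ for $t\le t_0$ and $u'(t)\ge0$ for a.e. $t\in\mathbb{R}$.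
   Context: Notation. $\mathbb{R}_+=[0,+\infty)$. $C_{loc}(\mathbb{R};\mathbb{R})$ is the space of continuous functions $\mathbb{R}\to\mathbb{R}$ with the topology of uniform convergence on every compact interval. $L_{loc}(\mathbb{R};\mathbb{R})$ is the space of locally Lebesgue-integrable functions on $\mathbb{R}$ with the topology of convergence in the mean on every compact interval. For $I,D\subseteq\mathbb{R}$: $C_0(I;D)$ is the set of bounded continuous functions $I\to D$; $AC_{loc}(I;D)$ is the set of functions $I\to D$ absolutely continuous on every compact interval contained in $I$; $L_{loc}(I;\mathbb{R}_+)$ is the set of functions $I\to\mathbb{R}_+$ integrable on every compact interval contained in $I$. $\|v\|=\sup\{|v(t)|:t\in\mathbb{R}\}$. $K_{loc}([t_0,+\infty)\times\mathbb{R}_+;\mathbb{R}_+)$ is the set of functions $q:[t_0,+\infty)\times\mathbb{R}_+\to\mathbb{R}_+$ such that $q(\cdot,x)$ is measurable for every $x$, $q(t,\cdot)$ is continuous for a.e. $t$, and for every compact $D\subset\mathbb{R}_+$ the function $\sup\{q(\cdot,x):x\in D\}$ is integrable on every compact subinterval of $[t_0,+\infty)$. Standing assumptions. $\ell_0,\ell_1:C_{loc}(\mathbb{R};\mathbb{R})\to L_{loc}(\mathbb{R};\mathbb{R})$ are linear continuous operators which are positive (map non-negative functions to non-negative functions). $f:C_{loc}(\mathbb{R};\mathbb{R})\to L_{loc}(\mathbb{R};\mathbb{R})$ is a continuous operator satisfying the local Carathéodory conditions: for every $r>0$ there is $q_r\in L_{loc}(\mathbb{R};\mathbb{R}_+)$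 with $|f(v)(t)|\le q_r(t)$ for a.e. $t\in\mathbb{R}$ whenever $\sup_{\mathbb{R}}|v|\le r$. If $I\subseteq\mathbb{R}$ is a closed interval, $u:I\to\mathbb{R}$ is continuous and $T:C_{loc}(\mathbb{R};\mathbb{R})\to L_{loc}(\mathbb{R};\mathbb{R})$ is a continuous operator, then $T(u):=T(\vartheta(u))$, where $\vartheta(u)$ is the extension of $u$ to $\mathbb{R}$ equal to $u(\inf I)$ to the left of $I$ (if $\inf I>-\infty$) and $u(\sup I)$ to the right of $I$ (if $\sup I<+\infty$). $T(0)$ is the value of $T$ at the zero function. For $\tau\in\mathbb{R}$, $V_\tau$ is the set of continuous operators $T:C_{loc}(\mathbb{R};\mathbb{R})\to L_{loc}(\mathbb{R};\mathbb{R})$ such that for every $\zeta\le\tau$, $T(u)(t)=T(v)(t)$ for a.e. $t\le\zeta$ whenever $u,v\in C_{loc}(\mathbb{R};\mathbb{R})$ and $u=v$ on $(-\infty,\zeta]$. $V=\bigcap_{\tau\in\mathbb{R}}V_\tau$. $\mathcal{P}^+_\tau$ is the set of linear continuous operators $\ell:C_{loc}(\mathbb{R};\mathbb{R})\to L_{loc}(\mathbb{R};\mathbb{R})$ such that $\ell(u)(t)\ge0$ for a.e. $t\le\tau$ whenever $u\in AC_{loc}((-\infty,\tau];\mathbb{R}_+)$ is nondecreasing. $\mathcal{P}^+=\bigcap_{\tau\in\mathbb{R}}\mathcal{P}^+_\tau$. A global solution is a function $u:\mathbb{R}\to\mathbb{R}$ absolutely continuous on every compact interval and satisfying the equation for a.e.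 $t\in\mathbb{R}$. *)

(* Defs.v *)
From HB Require Import structures.
From mathcomp Require Import all_boot all_order all_algebra.
From mathcomp Require Import all_classical all_reals all_analysis.

Set Implicit Arguments.
Unset Strict Implicit.
Unset Printing Implicit Defensive.
Import Order.TTheory GRing.Theory Num.Theory.
Import numFieldNormedType.Exports.
Local Open Scope classical_set_scope.
Local Open Scope ring_scope.

(* Measurability, integrability and "a.e." are all meant in the sense of
   Lebesgue: [completed_lebesgue_measure] lives on the Caratheodory (i.e.
   Lebesgue) sigma-algebra, while the library's [lebesgue_measure] only sees
   Borel sets.  The carrier of that measurable type is [R] itself. *)
Notation leb := (@completed_lebesgue_measure _).
Notation lebR R := (caratheodory_type (@wlength R idfun)^*%mu).

Definition Lebesgue_measurable_on (R : realType) (D : set R) (g : R -> R) :=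
  measurable_fun (D : set (lebR R)) (g : lebR R -> R).

Section function_spaces.
Context {R : realType}.
Implicit Types (u v : R -> R) (I D : set R).

Definition Cloc : set (R -> R) := [set u | continuous u].

Definition Lloc (g : R -> R) : Prop :=
  forall a b : R, leb.-integrable `[a, b] (EFin \o g).

Definition C0 D v : Prop :=
  [/\ continuous v, [bounded v t | t in [set: R]] & forall t, D (v t)].

Definition sup_norm v : \bar R := ereal_sup (range (fun t => `|v t|%:E)).

Definition abs_continuous (a b : R) u : Prop :=
  forall e : R, 0 < e -> exists2 d : R, 0 < d &
    forall (n : nat) (x y : 'I_n -> R),
      (forall i, a <= x i /\ x i <= y i /\ y i <= b) ->
      trivIset [set: 'I_n] (fun i => `]x i, y i[%classic) ->
      \sum_(i < n) (y i - x i) < d ->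
      \sum_(i < n) `|u (y i) - u (x i)| < e.

Definition ACloc I u : Prop :=
  forall a b : R, a <= b -> `[a, b] `<=` I -> abs_continuous a b u.

Definition Kloc (t0 : R) (q : R -> R -> R) : Prop :=
  [/\ forall t x : R, t0 <= t -> 0 <= x -> 0 <= q t x,
      forall x : R, 0 <= x -> Lebesgue_measurable_on `[t0, +oo[ (q ^~ x),
      {ae leb, forall t : R, t0 <= t -> {within `[0, +oo[, continuous (q t)}}
    & forall D : set R, compact D -> D !=set0 -> D `<=` `[0, +oo[ ->
        forall a b : R, t0 <= a ->
          leb.-integrable `[a, b]
            (fun t : R => ereal_sup [set (q t x)%:E | x in D])].

End function_spaces.

(* An operator C_loc -> L_loc is a map on functions of which only the values at
   continuous functions matter; [T u] is a representative of a class modulo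
   a.e. equality, so properties of [T u] are only ever stated a.e. *)
Section operators.
Context {R : realType}.
Implicit Types (T l : (R -> R) -> R -> R) (u v : R -> R).

(* Continuity at [u]: the topology of C_loc is that of compact convergence, and
   that of L_loc is given by the seminorms g |-> \int_a^b |g|. *)
Definition continuous_operator T : Prop :=
  (forall u, Cloc u -> Lloc (T u)) /\
  (forall u, Cloc u -> forall a b : R,
     (\int[leb]_(t in `[a, b]) `|T v t - T u t|%:E)%E
       @[v --> within Cloc (nbhs (u : {family compact, R -> R}))] --> 0%E).

Definition linear_operator T : Prop :=
  forall (k : R) u v, Cloc u -> Cloc v ->
    {ae leb, forall t : R,
       T (fun s => k * u s + v s) t = k * T u t + T v t}.

Definition positive_operator T : Prop :=
  forall u, Cloc u -> (forall t, 0 <= u t) ->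
    {ae leb, forall t : R, 0 <= T u t}.

Definition local_Caratheodory T : Prop :=
  forall r : R, 0 < r -> exists qr : R -> R,
    [/\ Lloc qr, forall t, 0 <= qr t &
        forall v, Cloc v -> (sup_norm v <= r%:E)%E ->
          {ae leb, forall t : R, `|T v t| <= qr t}].

Definition Vtau (tau : R) T : Prop :=
  continuous_operator T /\
  forall zeta : R, zeta <= tau -> forall u v, Cloc u -> Cloc v ->
    (forall t, t <= zeta -> u t = v t) ->
    {ae leb, forall t : R, t <= zeta -> T u t = T v t}.

Definition V T : Prop := forall tau : R, Vtau tau T.

(* The extension by constants of a function on (-oo, tau]. *)
Definition theta (tau : R) u : R -> R := fun t => u (Num.min t tau).

Definition Pplus_tau (tau : R) l : Prop :=
  [/\ continuous_operator l, linear_operator l &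
      forall u, ACloc `]-oo, tau] u ->
        (forall t, t <= tau -> 0 <= u t) ->
        (forall s t, s <= t -> t <= tau -> u s <= u t) ->
        {ae leb, forall t : R, t <= tau -> 0 <= l (theta tau u) t}].

Definition Pplus l : Prop := forall tau : R, Pplus_tau tau l.

Definition global_solution (F : (R -> R) -> R -> R) u : Prop :=
  ACloc [set: R] u /\
  {ae leb, forall t : R, derivable u t 1 /\ derive1 u t = F u t}.

End operators.

(* Main.v *)
Require Import Defs.
From HB Require Import structures.
From mathcomp Require Import all_boot all_order all_algebra.
From mathcomp Require Import all_classical all_reals all_analysis.
From mathcomp Require Import measurable_realfun lra.
Import Order.TTheory GRing.Theory Num.Theory.
Import numFieldNormedType.Exports.
Local Open Scope classical_set_scope.
Local Open Scope ring_scope.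

(** The solution is a limit of solutions of equations with a delayed argument,
    which, unlike the equation itself, can be solved step by step.

    Truncating the argument of [f] at the level [kappa] on the left of [t0]
    (see [trunc]) gives a right-hand side
    [F w = l0 w - l1 w + f (trunc w)] that is again a continuous Volterra
    operator, and that is nonnegative on all nonnegative nondecreasing
    functions: the linear part by membership in P+, the nonlinear part by the
    two sign conditions ([rhs_positive_on_nondecreasing]).  Fix [a], a delay
    [h > 0] and a constant initial value [x] on the left of [a].  The iteration
    [u := x + int_a^t F (u (. - h))] becomes stationary on one more interval of
    length [h] at each step, so that finitely many steps solve
    [u' = F (u (. - h))] on any bounded interval.  No uniqueness for the original
    equation is involved and yet these solutions depend continuously on [x].
    At [t0] the solution vanishes for [x = 0], because [F 0 = 0] there, and it is
    at least [c] for [x = c], because it is nondecreasing; the intermediate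
    value theorem yields a delayed solution with [u t0 = c]
    ([delayed_solution]).

    Since [c <= kappa], such a [u] stays in [[0, kappa]] on the left of [t0].
    On the right, [l0 w t <= w t * l0 1 t] for nondecreasing [w], while [l1 w >= 0]
    and [f] is sublinear; on an interval where the integral of [l0 1] is at most
    1/2 the growth of [u] is therefore bounded by an affine function of its
    value at the left end, and finitely many such intervals cover
    [[t0, b]] ([delayed_bounded]).  The derivatives then have a common locally
    integrable majorant ([delayed_modulus]), so the delayed solutions with
    [a = - n], [h = 1 / (n + 1)] are equicontinuous on compact intervals.  Along
    an ultrafilter they converge locally uniformly
    ([loc_equicontinuous_limit]), and continuity of [F] passes the integral
    equation to the limit [v] ([limit_solution]).  The truncation is inactive on
    [v].

    What remains is to differentiate an indefinite Lebesgue integral.  The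
    integrand is only Lebesgue measurable, and Lebesgue's differentiation theorem
    is applied to a Borel function that agrees with it almost everywhere
    ([borel_representative], [primitive_derive]). *)

Set Implicit Arguments.
Unset Strict Implicit.
Unset Printing Implicit Defensive.

(** * Borel representatives of Lebesgue measurable functions *)

(** Both measures restrict the same outer measure; they differ only in the
    sigma-algebra. *)
Lemma lebE (R : realType) (A : set R) :
  leb A = lebesgue_measure A.
Proof. by []. Qed.

Lemma borel_measurable_leb (R : realType) (A : set R) :
  measurable (A : set (measurableTypeR R)) -> measurable (A : set (lebR R)).
Proof. exact: sub_caratheodory. Qed.

(** Carathéodory measurable sets form the completion of the Borel
    sigma-algebra, and removing a Borel null set hides the completion. *)
Lemma lebesgue_borel_decomp (R : realType) (A : set R) :
  measurable (A : set (lebR R)) ->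
  exists B N : set R, [/\ measurable (B : set (measurableTypeR R)),
    measurable (N : set (measurableTypeR R)), lebesgue_measure N = 0%E &
    A `\` N = B `\` N].
Proof.
rewrite /= -[X in X _ -> _](@completed_caratheodory_measurable R).
rewrite g_sigma_completed_algebra_genE => -[/= X mX [N [/= M [mM M0 NM]]] <-].
exists X, M; split => //.
rewrite setDUl [X in _ `|` X](_ : _ = set0) ?setU0//.
by apply/seteqP; split=> x // [/NM].
Qed.

(** A sequence of reals, rather than a family indexed by rationals, lets countable
    unions be taken over [nat]. *)
Lemma rat_seq_dense (R : realType) (x y : R) : x < y ->
  exists n : nat, x < ratr (odflt 0 (@unpickle rat n)) < y.
Proof.
move=> xy; have [q qxy] := rat_in_itvoo xy; exists (pickle q).
by rewrite pickleK /=; move: qxy; rewrite in_itv.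
Qed.

(** Discard the countably many null sets by which the superlevel sets of [g]
    at rational heights fail to be Borel, and put [h = 0] there. *)
Lemma borel_representative (R : realType) (g : R -> R) :
  Lebesgue_measurable_on setT g ->
  exists (h : R -> R) (N : set R),
  [/\ measurable_fun setT (h : measurableTypeR R -> R),
    measurable (N : set (measurableTypeR R)), lebesgue_measure N = 0%E &
    forall x, ~ N x -> h x = g x].
Proof.
move=> mg; pose e n : R := ratr (odflt 0 (@unpickle rat n)).
have mE n : measurable (g @^-1` `]e n, +oo[ : set (lebR R)).
  by rewrite -[X in measurable X]setTI; apply: mg.
pose B n := projT1 (cid (lebesgue_borel_decomp (mE n))).
have BP n : exists N : set R, [/\ measurable (B n : set (measurableTypeR R)),
    measurable (N : set (measurableTypeR R)), lebesgue_measure N = 0%E &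
    g @^-1` `]e n, +oo[ `\` N = B n `\` N].
  by rewrite /B; case: cid.
pose M n := projT1 (cid (BP n)).
have MP n : [/\ measurable (B n : set (measurableTypeR R)),
    measurable (M n : set (measurableTypeR R)), lebesgue_measure (M n) = 0%E &
    g @^-1` `]e n, +oo[ `\` M n = B n `\` M n].
  by rewrite /M; case: cid.
pose N := \bigcup_n M n.
have mN : measurable (N : set (measurableTypeR R)).
  by apply: bigcupT_measurable => n; case: (MP n).
pose h x := if x \in N then 0 else g x.
have hE x : ~ N x -> h x = g x by rewrite /h; case: ifPn => // /set_mem.
have BE n x : ~ N x -> (e n < g x) <-> B n x.
  move=> Nx; have [_ _ _ E] := MP n.
  have Mx : ~ M n x by move=> Mx; apply: Nx; exists n.
  have [E1 E2] : (g @^-1` `]e n, +oo[ `\` M n) x <-> (B n `\` M n) x by rewrite E.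
  rewrite /= in_itv/= andbT in E1 E2.
  by split => H; [case: E1|case: E2].
exists h, N; split => //; last first.
  apply: (@measure_negligible _ _ _ lebesgue_measure) => //.
  by apply: negligible_bigcup => n; exists (M n); split => //; case: (MP n).
apply: (measurability _ (RGenOInfty.measurableE R)) => // _ [_ [r ->] <-].
rewrite setTI.
(* A real height [r] is approached from above by the rational ones. *)
have -> : h @^-1` `]r, +oo[ =
  (\bigcup_n (if r < e n then B n else set0) `\` N) `|` (if r < 0 then N else set0).
  apply/seteqP; split => x /=.
    rewrite in_itv/= andbT => rh.
    have [Nx|Nx] := pselect (N x).
      by right; move: rh; rewrite /h mem_set// => ->.
    left; split => //; rewrite hE // in rh.
    have [n /andP[n1 n2]] := rat_seq_dense rh.
    by exists n => //; rewrite /e n1; apply/BE.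
  rewrite in_itv/= andbT => -[[[n _]]|].
    case: ifPn => // rn Bn Nx; rewrite hE //; apply: (lt_trans rn).
    exact/BE.
  by case: ifPn => // r0 Nx; rewrite /h mem_set.
apply: measurableU; last by case: ifP.
apply: measurableD => //; apply: bigcupT_measurable => n; case: ifP => // _.
by case: (MP n).
Qed.

(** * Integration with respect to the completed Lebesgue measure *)

#[global] Instance ae_leb_filter (R : realType) :
  Filter (almost_everywhere (@completed_lebesgue_measure R)).
Proof. exact: (@ae_filter_ringOfSetsType _ (lebR R) R leb). Qed.

Lemma measurable_id_leb (R : realType) :
  measurable_fun setT (idfun : lebR R -> measurableTypeR R).
Proof. move=> _ A mA; rewrite setTI; exact: sub_caratheodory. Qed.

(** The Borel Lebesgue measure is the image of the completed one under the
    identity, so this is a change of variables. *)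
Lemma leb_integral_borel (R : realType) (h : R -> R) (D : set R) :
  measurable_fun setT (h : measurableTypeR R -> R) ->
  measurable (D : set (measurableTypeR R)) ->
  leb.-integrable D (EFin \o h) ->
  lebesgue_measure.-integrable D (EFin \o h) /\
  (\int[leb]_(t in D) (h t)%:E = \int[lebesgue_measure]_(t in D) (h t)%:E)%E.
Proof.
move=> mh mD ih.
have mEh : measurable_fun setT (EFin \o (h : measurableTypeR R -> R)).
  exact/measurable_EFinP.
have E (A : set (measurableTypeR R)) : measurable A -> A `<=` D ->
   pushforward (@completed_lebesgue_measure R)
     (idfun : lebR R -> measurableTypeR R) A = lebesgue_measure A by [].
have mid := @measurable_id_leb R.
have ip := integrable_pushforward mid mEh ih mD.
have := integral_pushforward mid mEh ih mD.
rewrite (eq_measure_integral (@lebesgue_measure R)) => [H|A mA AD]; last exact: E.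
split; last by rewrite -H.
move/integrableP : ip => [mhD hoo]; by apply/integrableP.
Qed.

Lemma leb_itv (R : realType) (x y : R) : x <= y -> leb `]x, y] = (y - x)%:E.
Proof.
by move=> xy; rewrite lebE lebesgue_measure_itv/= lte_fin;
  case: ltgtP xy => // -> _; rewrite subrr.
Qed.

Lemma measurable_itv_leb (R : realType) (i : interval R) :
  measurable ([set` i] : set (lebR R)).
Proof. by apply: borel_measurable_leb; exact: measurable_itv. Qed.

Lemma Lloc_itv (R : realType) (g : R -> R) (b1 b2 : bool) (x y : R) : Lloc g ->
  leb.-integrable [set` Interval (BSide b1 x) (BSide b2 y)] (EFin \o g).
Proof.
move=> /(_ x y); apply: integrableS; [exact: measurable_itv_leb..|].
by case: b1; case: b2 => t /=; rewrite !in_itv/= => /andP[xt ty];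
  rewrite ?(ltW xt) ?(ltW ty) ?xt ?ty.
Qed.

Lemma Lloc_measurable (R : realType) (g : R -> R) : Lloc g ->
  Lebesgue_measurable_on setT g.
Proof.
move=> Lg; rewrite /Lebesgue_measurable_on.
have -> : [set: R] = \bigcup_n `[(- n%:R : R), n%:R]%classic.
  apply/seteqP; split => // x _; have /ltW xn := archi_boundP (normr_ge0 x).
  by exists (Num.bound `|x|) => //=; rewrite in_itv/= -ler_norml.
apply/(@measurable_fun_bigcup _ _ (lebR R)) => n; first exact: measurable_itv_leb.
exact/measurable_EFinP/(measurable_int _ (Lg _ _)).
Qed.

Lemma Lloc_measurable_on (R : realType) (D : set R) (g : R -> R) : Lloc g ->
  Lebesgue_measurable_on D g.
Proof.
by move=> /Lloc_measurable; apply: measurable_funS.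
Qed.

Lemma Rintegral_oc_chasles (R : realType) (g : R -> R) (a b c : R) : Lloc g ->
  a <= b -> b <= c ->
  \int[leb]_(t in `]a, c]) g t = \int[leb]_(t in `]a, b]) g t + \int[leb]_(t in `]b,
    c]) g t.
Proof.
move=> Lg ab bc; rewrite -Rintegral_setU ?measurable_itv_leb//.
- by congr Rintegral; rewrite -itv_bndbnd_setU// bnd_simp.
- exact: measurable_itv_leb.
- exact: measurable_itv_leb.
- by rewrite -itv_bndbnd_setU ?bnd_simp//; exact: Lloc_itv.
- by apply/disj_setPS => t [] /=; rewrite !in_itv/= => /andP[_ tb] /andP[bt _];
    move: (lt_le_trans bt tb); rewrite ltxx.
Qed.

(** Almost everywhere the integrand equals its absolute value. *)
Lemma Rintegral_ae_ge0 (R : realType) (g : R -> R) (D : set R) :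
  measurable (D : set (lebR R)) -> leb.-integrable D (EFin \o g) ->
  {ae leb, forall t : R, D t -> 0 <= g t} -> 0 <= \int[leb]_(t in D) g t.
Proof.
move=> mD ig g0.
have mg := measurable_int _ ig.
have -> : \int[leb]_(t in D) g t = fine (\int[leb]_(t in D) (abse \o (EFin \o g)) t)%E.
  congr fine; apply: ae_eq_integral => //.
  - exact: measurableT_comp.
  - by apply: filterS g0 => t g0 /g0 /= {}g0; rewrite ger0_norm.
by apply: fine_ge0; apply: integral_ge0 => t _ /=; rewrite lee_fin.
Qed.

Lemma ae_le_Rintegral (R : realType) (g h : R -> R) (D : set R) :
  measurable (D : set (lebR R)) -> leb.-integrable D (EFin \o g) ->
  leb.-integrable D (EFin \o h) ->
  {ae leb, forall t : R, D t -> g t <= h t} ->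
  \int[leb]_(t in D) g t <= \int[leb]_(t in D) h t.
Proof.
move=> mD ig ih gh; rewrite -subr_ge0 -RintegralB//; apply: Rintegral_ae_ge0 => //.
  exact: (integrableB mD ih ig).
by apply: filterS gh => t gh /gh; rewrite subr_ge0.
Qed.

Lemma ae_eq_Rintegral (R : realType) (g h : R -> R) (D : set R) :
  measurable (D : set (lebR R)) -> leb.-integrable D (EFin \o g) ->
  leb.-integrable D (EFin \o h) ->
  {ae leb, forall t : R, D t -> g t = h t} ->
  \int[leb]_(t in D) g t = \int[leb]_(t in D) h t.
Proof.
move=> mD ig ih gh; apply/eqP; rewrite eq_le; apply/andP; split;
  apply: ae_le_Rintegral => //; apply: filterS gh => t gh /gh -> //.
Qed.

(** Absolute continuity of the integral. *)
Lemma Rintegral_small (R : realType) (g : R -> R) (a b e : R) : Lloc g -> 0 < e ->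
  exists2 d : R, 0 < d & forall A : set R, measurable (A : set (lebR R)) ->
    A `<=` `[a, b] -> (leb A < d%:E)%E -> \int[leb]_(t in A) `|g t| < e.
Proof.
move=> Lg e0; have ig := Lg a b; rewrite integrable_mkcond in ig;
  last exact: measurable_itv_leb.
rewrite restrict_EFin in ig.
have [d [d0 dP]] := integral_normr_continuous ig e0.
exists d => // A mA Aab Ad; apply: le_lt_trans (dP A mA Ad).
rewrite le_eqVlt; apply/orP; left; apply/eqP; apply: eq_Rintegral => t.
by rewrite inE => /Aab tab; rewrite patchE mem_set.
Qed.

(** * Indefinite integrals *)

(** Bridges the disjoint open intervals in the definition of absolute continuity
    and the half-open ones that make integrals additive. *)
Lemma Rintegral_oo_oc (R : realType) (g : R -> R) (x y : R) : Lloc g ->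
  \int[leb]_(t in `]x, y[) g t = \int[leb]_(t in `]x, y]) g t.
Proof.
move=> Lg; have [xy|yx] := ltP x y; last first.
  by rewrite !set_itv_ge // bnd_simp -leNgt.
have m1 : measurable ([set y] : set (lebR R)).
  by apply: borel_measurable_leb; exact: measurable_set1.
have l1 : leb [set y] = 0%E by rewrite lebE lebesgue_measure_set1.
have E : `]x, y]%classic = `]x, y[ `|` [set y] by rewrite setUitv1 ?bnd_simp.
rewrite E.
rewrite Rintegral_setU//.
- have -> : \int[leb]_(t in [set y]) g t = 0; last by rewrite addr0.
  rewrite /Rintegral null_set_integral; [by []|exact: m1| |exact: l1].
  exact/measurable_EFinP/Lloc_measurable_on.
- exact: measurable_itv_leb.
- by rewrite -E; exact: Lloc_itv.
- by apply/disj_setPS => t [] /=; rewrite in_itv/= => /andP[_ ty] yt; move: ty;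
    rewrite yt ltxx.
Qed.

(** The increments over disjoint intervals add up to at most the integral of
    [`|g|] over their union, a set of small measure. *)
Lemma primitive_ACloc (R : realType) (g u : R -> R) : Lloc g ->
  (forall x y, x <= y -> u y - u x = \int[leb]_(t in `]x, y]) g t) ->
  ACloc [set: R] u.
Proof.
move=> Lg ug a b ab _ e e0; have [d d0 dP] := Rintegral_small a b Lg e0.
exists d => // n x y xy tI xyd.
pose D := \big[setU/set0]_(i < n) `]x i, y i[%classic.
have mI i : measurable (`]x i, y i[%classic : set (lebR R)) by exact: measurable_itv_leb.
have mD : measurable (D : set (lebR R)) by exact: bigsetU_measurable.
have Dab : D `<=` `[a, b].
  move=> t; rewrite /D -bigcup_seq => -[i _] /=; rewrite !in_itv/= => /andP[xt ty].
  have [ax [_ yb]] := xy i.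
  by rewrite (ltW (le_lt_trans ax xt)) (ltW (lt_le_trans ty yb)).
apply: le_lt_trans (dP D mD Dab _); last first.
  rewrite measure_bigsetU_ord//= (_ : (\sum_(i < n) _)%E = (\sum_(i < n) (y i - x i))%:E).
    by rewrite lte_fin.
  rewrite -sumEFin; apply: eq_bigr => i _; have [_ [xiy _]] := xy i.
  by rewrite lebE lebesgue_measure_itv/= lte_fin; case: ltgtP xiy => // -> _;
    rewrite subrr.
have mg : measurable_fun (D : set (lebR R)) (fun t : lebR R => `|(g t)%:E|%E : \bar R).
  apply: (measurableT_comp (@abse_measurable R setT)).
  exact/measurable_EFinP/Lloc_measurable_on.
rewrite /Rintegral (@ge0_integral_bigsetU _ _ _ (@completed_lebesgue_measure R)) /=;
  first last.
- by move=> t _; rewrite lee_fin.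
- exact: mg.
- exact: sub_trivIset tI.
- exact: index_enum_uniq.
- exact: mI.
rewrite -sum_fine; last first.
  move=> i _; apply: integrable_fin_num => //; apply: integrable_norm => //.
  exact: Lloc_itv.
apply: ler_sum => i _; have [_ [xiy _]] := xy i.
rewrite ug // -Rintegral_oo_oc//.
apply: le_normr_Rintegral => //; exact: Lloc_itv.
Qed.

Lemma ACloc_continuous (R : realType) (u : R -> R) : ACloc [set: R] u -> continuous u.
Proof.
move=> ACu t; apply/cvgrPdist_lt => e e0.
have [| |d d0 dP] := ACu (t - 1) (t + 1) _ _ e e0 => //.
  by rewrite lerBlDr -addrA lerDl addr_ge0.
have aux x y : t - 1 <= x -> x <= y -> y <= t + 1 -> y - x < d -> `|u y - u x| < e.
  move=> tx xy yt yxd; have := dP 1%N (fun=> x) (fun=> y) (fun=> conj tx (conj xy yt)).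
  by rewrite !big_ord1; apply => //; move=> i j _ _ _; rewrite !ord1.
near=> s; have [st|/ltW ts] := leP s t.
  apply: aux => //.
  - by near: s; apply: lt_le_nbhsr; rewrite ltrBlDr ltrDl.
  - by rewrite lerDl.
  - by rewrite ltrBlDr -ltrBlDl; near: s; apply: lt_nbhsr; rewrite ltrBlDr ltrDl.
rewrite distrC; apply: aux => //.
- by rewrite lerBlDr lerDl.
- by near: s; apply: lt_le_nbhsl; rewrite ltrDl.
- by rewrite ltrBlDr addrC; near: s; apply: lt_nbhsl; rewrite ltrDl.
Unshelve. all: by end_near. Qed.

Lemma ae_borel_leb (R : realType) (P : R -> Prop) :
  {ae lebesgue_measure, forall t : R, P t} -> {ae leb, forall t : R, P t}.
Proof.
move=> [A [mA A0 PA]]; exists A; split => //; exact: borel_measurable_leb.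
Qed.

Lemma Lloc_ae_eq (R : realType) (g h : R -> R) : Lloc g ->
  Lebesgue_measurable_on setT h -> {ae leb, forall t : R, h t = g t} -> Lloc h.
Proof.
move=> Lg mh hg a b.
have mI := @measurable_itv_leb R `[a, b].
have mhI : Lebesgue_measurable_on `[a, b] h.
  by apply: measurable_funS mh => //; exact: (@measurableT _ (lebR R)).
have mgI : Lebesgue_measurable_on `[a, b] g by exact: Lloc_measurable_on.
have /integrableP[_ goo] := Lg a b.
apply/integrableP; split; first exact/measurable_EFinP.
have -> : (\int[leb]_(t in `[a, b]) `|(EFin \o h) t| =
  \int[leb]_(t in `[a, b]) `|(EFin \o g) t|)%E => //.
apply: ge0_ae_eq_integral.
- exact: mI.
- by apply: (measurableT_comp (@abse_measurable R setT)); exact/measurable_EFinP.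
- by apply: (measurableT_comp (@abse_measurable R setT)); exact/measurable_EFinP.
- by move=> t _; exact: abse_ge0.
- by move=> t _; exact: abse_ge0.
- by apply: filterS hg => t /= -> _.
Qed.

(** Lebesgue's differentiation theorem, applied to a Borel representative of
    [g]. *)
Lemma primitive_derive (R : realType) (g u : R -> R) : Lloc g ->
  (forall x y, x <= y -> u y - u x = \int[leb]_(t in `]x, y]) g t) ->
  {ae leb, forall t : R, derivable u t 1 /\ derive1 u t = g t}.
Proof.
move=> Lg ug; have [h [N [mh mN N0 hg]]] := borel_representative (Lloc_measurable Lg).
have Ng : {ae leb, forall t : R, h t = g t}.
  exists N; split; [exact: borel_measurable_leb|exact: N0|].
  by move=> t; apply: contra_notP => Nt; exact: hg.
have Lh : Lloc h.
  apply: (Lloc_ae_eq Lg) => //.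
  exact: (measurableT_comp mh (@measurable_id_leb R)).
have hI x y : lebesgue_measure.-integrable `]x, y] (EFin \o h) /\
   \int[leb]_(t in `]x, y]) g t = \int[lebesgue_measure]_(t in `]x, y]) h t.
  have [||i1 i2] := @leb_integral_borel R h `]x, y] mh => //.
    exact: Lloc_itv.
  split => //; rewrite [RHS]/Rintegral -i2.
  apply: ae_eq_Rintegral; [exact: measurable_itv_leb|exact: Lloc_itv|exact: Lloc_itv|].
  by apply: filterS Ng => t ->.
have lh : locally_integrable setT h.
  split; [exact: mh|exact: openT|] => K _ cK.
  have [M [_ MP]] := compact_bounded cK.
  pose n := `|M| + 1.
  have Kn : K `<=` `](- n - 1), n].
    move=> x Kx; have := MP n _ x Kx; rewrite /= in_itv/= /n => xn.
    have : `|x| <= `|M| + 1 by apply: xn; rewrite (le_lt_trans (ler_norm M))// ltrDl.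
    rewrite ler_norml => /andP[x1 ->]; rewrite andbT (lt_le_trans _ x1)//.
    by rewrite ltrBlDr ltrDl.
  have [/integrableP[_ oo]] := hI (- n - 1) n.
  move=> _; apply: le_lt_trans oo; apply: ge0_subset_integral => //.
  + exact: compact_measurable.
  + apply: measurableT_comp => //; apply: measurableT_comp => //; exact: measurable_funTS.
have := ae_borel_leb (lebesgue_differentiation lh).
apply: filterS2 Ng => t tg ht.
have at' : t - 1 < t by rewrite ltrBlDr ltrDl.
have tb : t < t + 1 by rewrite ltrDl.
have [|] := @FTC1_lebesgue_pt _ h (BRight (t - 1)) t _ tb (hI _ _).1 _ ht.
  by [].
(* [F] is the primitive based at [t - 1], which represents [u] near [t]. *)
set F := fun y => _ => dF F't.
have uF : \forall s \near t, u (t - 1) + F s = u s.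
  near=> s; have st : t - 1 <= s by near: s; apply: lt_le_nbhsr.
  by rewrite /F -(hI _ _).2 -(ug _ _ st) addrC subrK.
have dc : derivable (fun=> u (t - 1)) t 1 by exact: derivable_cst.
have dF' : derivable (fun s => u (t - 1) + F s) t 1.
  exact: (derivableD dc dF).
split; first exact: near_eq_derivable dF'.
rewrite -tg -F't !derive1E -(near_eq_derive _ uF) (deriveD dc dF).
by rewrite derive_cst add0r.
Unshelve. all: by end_near. Qed.

(** The integral from [a], which vanishes on the left of [a], is the primitive
    on the whole line of [g] cut off at [a]; this makes the results on primitives
    available for it. *)
Lemma Rintegral_ray (R : realType) (g : R -> R) (a : R) : Lloc g ->
  Lloc (g \_ `]a, +oo[) /\
  forall x y, x <= y -> \int[leb]_(t in `]a, y]) g t - \int[leb]_(t in `]a, x]) g t =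
     \int[leb]_(t in `]x, y]) (g \_ `]a, +oo[) t.
Proof.
move=> Lg; have Lgr : Lloc (g \_ `]a, +oo[).
  move=> x y; rewrite -restrict_EFin -integrable_restrict;
    [|exact: measurable_itv_leb|exact: measurable_itv_leb].
  apply: integrableS (Lg x y) => //.
  - exact: measurable_itv_leb.
  - by apply: measurableI; exact: measurable_itv_leb.
split => //.
have E x y : a <= x -> x <= y ->
  \int[leb]_(t in `]x, y]) (g \_ `]a, +oo[) t = \int[leb]_(t in `]x, y]) g t.
  move=> ax xy; apply: eq_Rintegral => t; rewrite inE/= in_itv/= => /andP[xt _].
  by rewrite patchE mem_set//= in_itv/= andbT (le_lt_trans ax).
have E0 y : y <= a -> \int[leb]_(t in `]a, y]) g t = 0.
  by move=> ya; rewrite set_itv_ge ?bnd_simp -?leNgt// Rintegral_set0.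
have Z x y : y <= a -> \int[leb]_(t in `]x, y]) (g \_ `]a, +oo[) t = 0.
  move=> ya; rewrite /Rintegral integral0_eq// => t /=; rewrite in_itv/= => /andP[_ ty].
  by rewrite patchE memNset//= in_itv/= andbT; apply/negP; rewrite -leNgt (le_trans ty).
move=> x y xy; have [ax|/ltW xa] := leP a x.
  by rewrite E// (Rintegral_oc_chasles Lg ax xy) addrC addKr.
rewrite (E0 x xa) subr0; have [ya|/ltW ay] := leP y a; first by rewrite E0// Z.
by rewrite (Rintegral_oc_chasles Lgr xa ay) Z// add0r E.
Qed.

(** * Continuous operators along an arbitrary filter *)

(** Convergence uniform on compact intervals; the symmetric intervals are
    cofinal among them. *)
Definition compact_cvg (R : realType) (I : Type) (G : set_system I)
  (v : I -> R -> R) (u : R -> R) :=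
  forall A e : R, 0 < e ->
    \forall i \near G, forall t, `|t| <= A -> `|v i t - u t| < e.

(** Convergence in the mean on compact intervals, that is, in L_loc. *)
Definition mean_cvg (R : realType) (I : Type) (G : set_system I)
  (v : I -> R -> R) (u : R -> R) :=
  forall a b e : R, 0 < e ->
    \forall i \near G, \int[leb]_(t in `]a, b]) `|v i t - u t| < e.

(** Continuity from C_loc to L_loc tested on arbitrary filters: it is used both
    along a neighbourhood filter of initial values and along an ultrafilter on
    [nat]. *)
Definition mean_continuous (R : realType) (T : (R -> R) -> R -> R) :=
  (forall u, continuous u -> Lloc (T u)) /\
  forall (I : Type) (G : set_system I) (v : I -> R -> R) (u : R -> R),
    Filter G -> (forall i, continuous (v i)) -> continuous u ->
    compact_cvg G v u -> mean_cvg G (fun i => T (v i)) (T u).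

Lemma compact_cvg_family (R : realType) (I : Type) (G : set_system I)
  (v : I -> R -> R) (u : R -> R) :
  Filter G -> compact_cvg G v u -> {family compact, v @ G --> u}.
Proof.
move=> FG vu; apply/fam_cvgP => K cK U /=; rewrite uniform_nbhs => -[E [entE EU]].
have [e e0 eE] : exists2 e : R, 0 < e & forall x y : R, `|x - y| < e -> E (x, y).
  move: entE; rewrite -entourage_ballE => -[e e0 eE].
  by exists e => // x y xy; apply: (eE (x, y)).
have [M [_ MP]] := compact_bounded cK.
have := vu (`|M| + 1) e e0; apply: filterS => i vi; apply: EU => t Kt /=.
apply: eE; rewrite distrC; apply: vi; apply: MP => //.
by rewrite (le_lt_trans (ler_norm M))// ltrDl.
Qed.

Lemma continuous_operator_mean (R : realType) (T : (R -> R) -> R -> R) :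
  continuous_operator T -> mean_continuous T.
Proof.
move=> [TL Tc]; split => // I G v u FG cv cu vu a b e e0.
have ne : nbhs (0%E : \bar R) [set x | (x < e%:E)%E].
  by apply: open_ereal_lt'; rewrite lte_fin.
have H := Tc u cu a b _ ne.
have : \forall i \near G, Cloc (v i) ->
  (\int[leb]_(t in `[a, b]) `|T (v i) t - T u t|%:E < e%:E)%E.
  exact: (compact_cvg_family FG vu H).
apply: filterS => i /(_ (cv i)) Hi.
have Lg : Lloc (fun t => `|T (v i) t - T u t|).
  move=> x y.
  have := integrableB (measurable_itv_leb _) (TL _ (cv i) x y) (TL _ cu x y).
  exact: integrable_norm.
have mg : Lebesgue_measurable_on setT (fun t => `|T (v i) t - T u t|).
  exact: Lloc_measurable.
rewrite -lte_fin /Rintegral fineK; last first.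
  by apply: integrable_fin_num; [exact: measurable_itv_leb|exact: Lloc_itv].
apply: le_lt_trans Hi; apply: ge0_subset_integral.
- exact: measurable_itv_leb.
- exact: measurable_itv_leb.
- exact/measurable_EFinP/Lloc_measurable_on.
- by move=> t _; rewrite lee_fin.
- by move=> t /=; rewrite !in_itv/= => /andP[/ltW -> ->].
Qed.

Lemma LlocD (R : realType) (g h : R -> R) : Lloc g -> Lloc h -> Lloc (fun t => g t + h t).
Proof.
by move=> Lg Lh x y; exact: (integrableD (measurable_itv_leb _) (Lg x y) (Lh x y)).
Qed.

Lemma LlocB (R : realType) (g h : R -> R) : Lloc g -> Lloc h -> Lloc (fun t => g t - h t).
Proof.
by move=> Lg Lh x y; exact: (integrableB (measurable_itv_leb _) (Lg x y) (Lh x y)).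
Qed.

Lemma Lloc_norm (R : realType) (g : R -> R) : Lloc g -> Lloc (fun t => `|g t|).
Proof. by move=> Lg x y; exact: (integrable_norm (Lg x y)). Qed.

Lemma LlocZ (R : realType) (k : R) (g : R -> R) : Lloc g -> Lloc (fun t => k * g t).
Proof. by move=> Lg x y; exact: (integrableZl (measurable_itv_leb _) k (Lg x y)). Qed.

Lemma subset_Rintegral (R : realType) (g : R -> R) (a b c d : R) : Lloc g ->
  (forall t, 0 <= g t) -> a <= c -> d <= b ->
  \int[leb]_(t in `]c, d]) g t <= \int[leb]_(t in `]a, b]) g t.
Proof.
move=> Lg g0 ac db; rewrite /Rintegral; apply: fine_le.
- by apply: integrable_fin_num; [exact: measurable_itv_leb|exact: Lloc_itv].
- by apply: integrable_fin_num; [exact: measurable_itv_leb|exact: Lloc_itv].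
apply: ge0_subset_integral.
- exact: measurable_itv_leb.
- exact: measurable_itv_leb.
- exact/measurable_EFinP/Lloc_measurable_on.
- by move=> t _; rewrite lee_fin.
- move=> t /=; rewrite !in_itv/= => /andP[ct td].
  by rewrite (le_lt_trans ac) ?(le_trans td).
Qed.

Lemma mean_cvgD (R : realType) (I : Type) (G : set_system I)
  (v v' : I -> R -> R) (u u' : R -> R) :
  Filter G -> (forall i, Lloc (v i)) -> (forall i, Lloc (v' i)) -> Lloc u -> Lloc u' ->
  mean_cvg G v u -> mean_cvg G v' u' ->
  mean_cvg G (fun i t => v i t + v' i t) (fun t => u t + u' t).
Proof.
move=> FG Lv Lv' Lu Lu' vu vu' a b e e0.
have e20 : 0 < e / 2 by rewrite divr_gt0.
apply: filterS2 (vu a b _ e20) (vu' a b _ e20) => i H H'.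
have L1 : Lloc (fun t => `|v i t - u t|) by apply/Lloc_norm/LlocB.
have L2 : Lloc (fun t => `|v' i t - u' t|) by apply/Lloc_norm/LlocB.
rewrite [e]splitr; apply: le_lt_trans (ltrD H H').
rewrite -RintegralD; [|exact: measurable_itv_leb|exact: Lloc_itv|exact: Lloc_itv].
apply: le_Rintegral; [exact: measurable_itv_leb| | |].
- by apply: Lloc_itv; apply/Lloc_norm/LlocB; apply: LlocD.
- by apply: Lloc_itv; apply: LlocD.
- by move=> t _; rewrite opprD addrACA ler_normD.
Qed.

Lemma mean_cvgB (R : realType) (I : Type) (G : set_system I)
  (v v' : I -> R -> R) (u u' : R -> R) :
  Filter G -> (forall i, Lloc (v i)) -> (forall i, Lloc (v' i)) -> Lloc u -> Lloc u' ->
  mean_cvg G v u -> mean_cvg G v' u' ->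
  mean_cvg G (fun i t => v i t - v' i t) (fun t => u t - u' t).
Proof.
have LN g : Lloc g -> Lloc (fun t : R => - g t).
  by move=> Lg x y; exact: (integrableN (Lg x y)).
move=> FG Lv Lv' Lu Lu' vu vu'; apply: mean_cvgD => //;
  [by move=> i; exact: LN|exact: LN|].
move=> a b e e0; apply: filterS (vu' a b e e0) => i; apply: le_lt_trans.
by rewrite le_eqVlt; apply/orP; left; apply/eqP/eq_Rintegral => t _;
  rewrite -opprD normrN.
Qed.

(** Convergence in the mean makes the integrals converge uniformly over all
    subintervals. *)
Lemma mean_cvg_Rintegral (R : realType) (I : Type) (G : set_system I)
  (v : I -> R -> R) (u : R -> R) :
  Filter G -> (forall i, Lloc (v i)) -> Lloc u -> mean_cvg G v u ->
  forall a b e : R, 0 < e -> \forall i \near G, forall s t, a <= s -> t <= b ->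
   `|\int[leb]_(r in `]s, t]) v i r - \int[leb]_(r in `]s, t]) u r| < e.
Proof.
move=> FG Lv Lu vu a b e e0; apply: filterS (vu a b e e0) => i H s t as_ tb.
rewrite -RintegralB; [|exact: measurable_itv_leb|exact: Lloc_itv|exact: Lloc_itv].
apply: le_lt_trans H; apply: le_trans.
  by apply: le_normr_Rintegral; [exact: measurable_itv_leb|apply: Lloc_itv; exact: LlocB].
apply: subset_Rintegral => //.
by apply/Lloc_norm/LlocB.
Qed.

Lemma mean_continuousD (R : realType) (S T : (R -> R) -> R -> R) :
  mean_continuous S -> mean_continuous T ->
  mean_continuous (fun u t => S u t + T u t).
Proof.
move=> [LS cS] [LT cT]; split; first by move=> u cu; apply: LlocD; [exact: LS|exact: LT].
move=> I G v u FG cv cu vu; apply: mean_cvgD => //;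
  [by move=> i; exact: LS|by move=> i; exact: LT|exact: LS|exact: LT|exact: cS|exact: cT].
Qed.

Lemma mean_continuousB (R : realType) (S T : (R -> R) -> R -> R) :
  mean_continuous S -> mean_continuous T ->
  mean_continuous (fun u t => S u t - T u t).
Proof.
move=> [LS cS] [LT cT]; split; first by move=> u cu; apply: LlocB; [exact: LS|exact: LT].
move=> I G v u FG cv cu vu; apply: mean_cvgB => //;
  [by move=> i; exact: LS|by move=> i; exact: LT|exact: LS|exact: LT|exact: cS|exact: cT].
Qed.

(** * Truncation on the left of a point *)

(** On the left of [t0] this is [min (w t) k]; on the right, [w] is shifted by the
    amount cut off at [t0].  A shift, unlike a cut, puts no bound on the growth to
    the right of [t0], and it leaves [w] unchanged as soon as [w <= k] on the left
    of [t0]. *)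
Definition trunc (R : realType) (t0 k : R) (w : R -> R) : R -> R :=
  fun t => w t - Num.max (w (Num.min t t0) - k) 0.

Lemma trunc_continuous (R : realType) (t0 k : R) (w : R -> R) : continuous w ->
  continuous (trunc t0 k w).
Proof.
move=> cw t; apply: cvgB; first exact: cw.
apply: (@continuous_max R R (fun s => w (Num.min s t0) - k) (fun=> 0) t).
  apply: cvgB; last exact: cvg_cst.
  apply: (@continuous_comp _ _ _ (fun s => Num.min s t0) w); last exact: cw.
  apply: (@continuous_min R R id (fun=> t0) t); [exact: cvg_id|exact: cvg_cst].
exact: cvg_cst.
Qed.

Lemma ler_norm_max0 (R : realType) (x y k : R) :
  `|Num.max (x - k) 0 - Num.max (y - k) 0| <= `|x - y|.
Proof.
by rewrite ler_norml /Num.max; do 2 case: ltP => ?; case: (ger0P (x - y)) => ?; lra.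
Qed.

Lemma norm_min_le (R : realType) (t s : R) : `|Num.min t s| <= `|t| + `|s|.
Proof. by rewrite /Num.min; case: ltP => _; rewrite ?lerDl ?lerDr. Qed.

Lemma trunc_compact_cvg (R : realType) (I : Type) (G : set_system I) (t0 k : R)
  (v : I -> R -> R) (u : R -> R) :
  Filter G -> compact_cvg G v u ->
  compact_cvg G (fun i => trunc t0 k (v i)) (trunc t0 k u).
Proof.
move=> FG vu A e e0; have e20 : 0 < e / 2 by rewrite divr_gt0.
apply: filterS (vu (A + `|t0|) _ e20) => i H t tA.
have H1 : `|v i t - u t| < e / 2 by apply: H; rewrite (le_trans tA)// lerDl.
have H2 : `|v i (Num.min t t0) - u (Num.min t t0)| < e / 2.
  by apply: H; rewrite (le_trans (norm_min_le _ _))// lerD2r.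
have H3 := ler_norm_max0 (v i (Num.min t t0)) (u (Num.min t t0)) k.
have -> : trunc t0 k (v i) t - trunc t0 k u t = (v i t - u t) -
    (Num.max (v i (Num.min t t0) - k) 0 - Num.max (u (Num.min t t0) - k) 0).
  by rewrite /trunc; lra.
rewrite [e]splitr; apply: le_lt_trans (ltrD H1 H2).
by rewrite (le_trans (ler_normB _ _))// lerD2l.
Qed.

Lemma mean_continuous_trunc (R : realType) (t0 k : R) (T : (R -> R) -> R -> R) :
  mean_continuous T -> mean_continuous (fun u => T (trunc t0 k u)).
Proof.
move=> [LT cT]; split; first by move=> u cu; apply: LT; exact: trunc_continuous.
move=> I G v u FG cv cu vu; apply: cT => //;
  [|exact: trunc_continuous|exact: trunc_compact_cvg].
by move=> i; exact: trunc_continuous.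
Qed.

(** * Delayed equations *)

Definition delay (R : realType) (h : R) (w : R -> R) : R -> R := fun t => w (t - h).

(** Picard iterates of the delayed equation [u' = F (u (. - h))] with the value
    [x] on the left of [a]. *)
Fixpoint tonelli (R : realType) (F : (R -> R) -> R -> R)
  (a h : R) (k : nat) (x : R) : R -> R :=
  if k is k'.+1 then
    fun t => x + \int[leb]_(s in `]a, t]) F (delay h (tonelli F a h k' x)) s
  else fun=> x.

(** The Volterra property at all times at once. *)
Definition causal (R : realType) (F : (R -> R) -> R -> R) :=
  forall (z : R) u v, continuous u -> continuous v -> (forall t, t <= z -> u t = v t) ->
    {ae leb, forall t : R, t <= z -> F u t = F v t}.

Definition positive_on_nondecreasing (R : realType) (F : (R -> R) -> R -> R) :=
  forall w : R -> R, ACloc [set: R] w -> (forall t, 0 <= w t) ->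
    (forall s t, s <= t -> w s <= w t) -> {ae leb, forall t : R, 0 <= F w t}.

Lemma ACloc_delay (R : realType) (h : R) (w : R -> R) :
  ACloc [set: R] w -> ACloc [set: R] (delay h w).
Proof.
move=> ACw a b ab _ e e0.
have [|//|d d0 dP] := ACw (a - h) (b - h) _ _ e e0; first by rewrite lerD2r.
exists d => // n x y xy tI xyd.
apply: (dP n (fun i => x i - h) (fun i => y i - h)).
- by move=> i; have [ax [xiy yb]] := xy i; rewrite !lerD2r.
- move=> i j _ _ [t [/=]]; rewrite !in_itv/= !ltrBlDr !ltrBrDr => ti tj.
  by apply: tI => //; exists (t + h); split; rewrite /= in_itv/=; lra.
- apply: le_lt_trans xyd; rewrite le_eqVlt; apply/orP; left; apply/eqP.
  by apply: eq_bigr => i _; lra.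
Qed.

Lemma delay_continuous (R : realType) (h : R) (w : R -> R) :
  continuous w -> continuous (delay h w).
Proof.
move=> cw t; apply: (@continuous_comp _ _ _ (fun s => s - h) w); last exact: cw.
by apply: cvgB; [exact: cvg_id|exact: cvg_cst].
Qed.

Lemma delay_compact_cvg (R : realType) (I : Type) (G : set_system I) (h : R)
  (v : I -> R -> R) (u : R -> R) :
  Filter G -> compact_cvg G v u -> compact_cvg G (fun i => delay h (v i)) (delay h u).
Proof.
move=> FG vu A e e0; apply: filterS (vu (A + `|h|) e e0) => i H t tA.
by apply: H; rewrite (le_trans (ler_normB _ _))// lerD2r.
Qed.

Section tonelli.
Variables (R : realType) (F : (R -> R) -> R -> R) (a h : R).
Hypothesis (cF : mean_continuous F).
Let T := tonelli F a h.

Lemma tonelli_left k x t : t <= a -> T k x t = x.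
Proof.
case: k => [//|k] ta; rewrite /T/= set_itv_ge ?bnd_simp -?leNgt//.
by rewrite Rintegral_set0 addr0.
Qed.

Lemma tonelli_AC k x : ACloc [set: R] (T k x).
Proof.
elim: k => [|k IH].
  move=> a' b' _ _ e e0; exists 1 => // n y z _ _ _ /=.
  by rewrite big1// => i _; rewrite subrr normr0.
have Lg : Lloc (F (delay h (T k x))).
  by apply: cF.1; apply: delay_continuous; exact: ACloc_continuous.
have [Lr rE] := Rintegral_ray a Lg.
apply: (primitive_ACloc Lr) => s t st; rewrite -rE//=.
by rewrite opprD addrACA subrr add0r.
Qed.

Lemma tonelli_continuous k x : continuous (delay h (T k x)).
Proof. by apply: delay_continuous; apply: ACloc_continuous; exact: tonelli_AC. Qed.

Lemma tonelli_Lloc k x : Lloc (F (delay h (T k x))).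
Proof. by apply: cF.1; exact: tonelli_continuous. Qed.

Lemma tonelli_diff k x s t : a <= s -> s <= t ->
  T k.+1 x t - T k.+1 x s = \int[leb]_(r in `]s, t]) F (delay h (T k x)) r.
Proof.
move=> as_ st; rewrite /T/= (Rintegral_oc_chasles (@tonelli_Lloc k x) as_ st).
by rewrite opprD addrACA subrr add0r addrC addKr.
Qed.

(** The integrand of each step is nonnegative because the previous iterate is
    nonnegative and nondecreasing. *)
Lemma tonelli_nd k x : positive_on_nondecreasing F -> 0 <= x ->
  (forall s t, s <= t -> T k x s <= T k x t) /\ (forall t, x <= T k x t).
Proof.
move=> Fp x0; elim: k => [//|k [nd ge]].
have F0 : {ae leb, forall t : R, 0 <= F (delay h (T k x)) t}.
  apply: Fp; first by apply: ACloc_delay; exact: tonelli_AC.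
    by move=> t; exact: le_trans (ge _).
  by move=> s t st; apply: nd; rewrite lerD2r.
have nd' s t : s <= t -> T k.+1 x s <= T k.+1 x t.
  move=> st; rewrite -subr_ge0 /T/= opprD addrACA subrr add0r.
  have [_ ->//] := Rintegral_ray a (@tonelli_Lloc k x).
  apply: Rintegral_ae_ge0; first exact: measurable_itv_leb.
    by apply: Lloc_itv; apply: (Rintegral_ray a (@tonelli_Lloc k x)).1.
  by apply: filterS F0 => r Fr _; rewrite patchE; case: ifP.
split => // t; have [ta|/ltW at_] := leP t a; first by rewrite tonelli_left.
by rewrite -{1}(@tonelli_left k.+1 x a)//; exact: nd'.
Qed.

(** By causality the delay carries an agreement up to [z] over to an agreement up
    to [z + h] of the next iterates. *)
Lemma tonelli_agree k x t : causal F -> 0 <= h -> t <= a + h *+ k -> T k.+1 x t = T k x t.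
Proof.
move=> caus h0; elim: k t => [|k IH] t tk.
  by rewrite mulr0n addr0 in tk; rewrite !tonelli_left.
have H s : s <= a + h *+ k.+1 -> delay h (T k.+1 x) s = delay h (T k x) s.
  by move=> sk; apply: IH; rewrite lerBlDr -addrA -mulrSr.
have := caus _ _ _ (@tonelli_continuous k.+1 x) (@tonelli_continuous k x) H.
move=> {}H; change (x + \int[leb]_(s in `]a, t]) F (delay h (T k.+1 x)) s =
  x + \int[leb]_(s in `]a, t]) F (delay h (T k x)) s).
congr (_ + _); apply: ae_eq_Rintegral.
- exact: measurable_itv_leb.
- by apply: Lloc_itv; exact: (@tonelli_Lloc k.+1 x).
- by apply: Lloc_itv; exact: (@tonelli_Lloc k x).
apply: filterS H => s Hs /=; rewrite in_itv/= => /andP[_ st].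
by apply: Hs; exact: le_trans tk.
Qed.

Lemma tonelli_zero k t0 : causal F -> 0 <= h ->
  {ae leb, forall t : R, t <= t0 -> F (fun=> 0) t = 0} ->
  forall t, t <= t0 -> T k 0 t = 0.
Proof.
move=> caus h0 F0; elim: k => [//|k IH] t tt0; rewrite /T/= add0r.
have H s : s <= t0 -> delay h (T k 0) s = (fun=> 0) s.
  by move=> st0; apply: IH; rewrite lerBlDr (le_trans st0)// lerDl.
have {}H := caus _ _ _ (@tonelli_continuous k 0) (@cst_continuous R R 0) H.
have L0 : Lloc (fun=> 0 : R).
  by move=> y z; exact: (integrable0 (@completed_lebesgue_measure R)).
transitivity (\int[leb]_(s in `]a, t]) (0 : R)); last by rewrite /Rintegral integral0.
apply: ae_eq_Rintegral.
- exact: measurable_itv_leb.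
- by apply: Lloc_itv; exact: (@tonelli_Lloc k 0).
- exact: Lloc_itv.
apply: filterS2 H F0 => s Hs F0s /=; rewrite in_itv/= => /andP[_ st].
have st0 := le_trans st tt0.
by rewrite -[RHS]F0s// -Hs.
Qed.

(** An iterate depends continuously on the initial value, since each step
    composes continuous maps. *)
Lemma tonelli_compact_cvg k x0 : compact_cvg (nbhs x0) (T k) (T k x0).
Proof.
have x0x e : 0 < e -> \forall x \near x0, `|x - x0| < e.
  by move=> e0; near=> x; rewrite distrC; near: x; exact: cvgr_dist_lt.
elim: k => [|k IH] A e e0.
  by apply: filterS (x0x e e0) => x + t _.
have e20 : 0 < e / 2 by rewrite divr_gt0.
have H := cF.2 _ _ _ _ (nbhs_filter x0) (@tonelli_continuous k)
  (@tonelli_continuous k x0) (delay_compact_cvg h (nbhs_filter x0) IH).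
have := mean_cvg_Rintegral (nbhs_filter x0) (@tonelli_Lloc k)
  (@tonelli_Lloc k x0) H a A e20.
have : \forall x \near x0, `|x - x0| < e / 2.
  exact: x0x.
apply: filterS2 => x xx0 HI t tA; rewrite /T/= opprD addrACA [e]splitr.
apply: (le_lt_trans (ler_normD _ _)); apply: ltrD => //.
by apply: HI => //; exact: le_trans (ler_norm _) tA.
Unshelve. all: by end_near. Qed.

End tonelli.

(** Shooting: the initial value on the left of [a] is chosen so that the solution
    passes through [c] at [t0]. *)
Lemma delayed_solution (R : realType) (F : (R -> R) -> R -> R) (a h b t0 c : R) :
  mean_continuous F -> causal F -> positive_on_nondecreasing F ->
  {ae leb, forall t : R, t <= t0 -> F (fun=> 0) t = 0} -> 0 < h -> 0 <= c ->
  exists u : R -> R, [/\ ACloc [set: R] u, forall s t, s <= t -> u s <= u t,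
    forall t, 0 <= u t, u t0 = c &
    forall s t, a <= s -> s <= t -> t <= b ->
      u t - u s = \int[leb]_(r in `]s, t]) F (delay h u) r].
Proof.
move=> cF caus Fp F0 h0 c0.
(* With [k] steps the iteration is stationary up to [b]. *)
have [k kb] : exists k : nat, b <= a + h *+ k.
  exists (Num.bound `|(b - a) / h|); rewrite -lerBlDl -mulr_natr mulrC -ler_pdivrMr//.
  by rewrite (le_trans (ler_norm _))// ltW// archi_boundP.
pose U := tonelli F a h k.+1.
have cU : {within `[0, c], continuous (fun x => U x t0)}.
  apply: continuous_subspaceT => x; apply/cvgrPdist_lt => e e0.
  have := tonelli_compact_cvg a h cF k.+1 x `|t0| e0; apply: filterS => y.
  by move=> /(_ t0 (lexx _)); rewrite distrC.
have U0 : U 0 t0 = 0 by apply: (tonelli_zero a cF k.+1 caus (ltW h0) F0).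
have Uc : c <= U c t0 by exact: (tonelli_nd a h cF k.+1 Fp c0).2.
(* Only the iterates started in [[0, c]] are needed, as [U c t0 >= c]. *)
have [||x xc Ux] := IVT _ cU (v := c) => //.
  by rewrite U0 min_l ?max_r ?c0 ?Uc ?(le_trans c0 Uc).
move: xc; rewrite in_itv/= => /andP[x0 _].
have [nd ge] := tonelli_nd a h cF k.+1 Fp x0.
exists (U x); split => //.
- exact: tonelli_AC.
- by move=> t; exact: le_trans (ge t).
- move=> s t as_ st tb; rewrite tonelli_diff//.
  have H r : r <= b -> delay h (tonelli F a h k x) r = delay h (U x) r.
    move=> rb; rewrite /delay [RHS]tonelli_agree//; first exact: ltW.
    by rewrite (le_trans _ kb)// (le_trans _ rb)// gerBl ltW.
  have {}H := caus _ _ _ (@tonelli_continuous _ _ a h cF k x)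
    (@tonelli_continuous _ _ a h cF k.+1 x) H.
  apply: ae_eq_Rintegral.
  + exact: measurable_itv_leb.
  + by apply: Lloc_itv; exact: (tonelli_Lloc a h cF k x).
  + by apply: Lloc_itv; exact: (tonelli_Lloc a h cF k.+1 x).
  apply: filterS H => r Hr /=; rewrite in_itv/= => /andP[_ rt].
  by apply: Hr; exact: le_trans tb.
Qed.

(** * Compactness of equicontinuous sequences *)

(** Equicontinuity, uniform on compact intervals, of the tails of a sequence: the
    delayed solutions solve their equations on growing intervals only. *)
Definition loc_equicontinuous (R : realType) (u : nat -> R -> R) :=
  forall A e : R, 0 < e -> exists2 d : R, 0 < d &
    \forall n \near \oo, forall s t, `|s| <= A -> `|t| <= A -> `|s - t| < d ->
      `|u n s - u n t| < e.

(** The Arzelà-Ascoli theorem.  An ultrafilter finer than [\oo] replaces the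
    diagonal extraction of a subsequence: along it bounded real sequences
    converge, and equicontinuity upgrades the pointwise limit. *)
Lemma loc_equicontinuous_limit (R : realType) (u : nat -> R -> R) :
  loc_equicontinuous u ->
  (forall t, exists M, \forall n \near \oo, `|u n t| <= M) ->
  exists (G : set_system nat) (v : R -> R),
    [/\ ProperFilter G, \oo `<=` G, continuous v & compact_cvg G u v].
Proof.
move=> equ bdd; have [G [UG ooG]] := @ultraFilterLemma nat \oo _.
have PG : ProperFilter G by exact: ultra_proper.
have lim t : exists l, forall e, 0 < e -> \forall n \near G, `|u n t - l| < e.
  have [M /ooG HM] := bdd t.
  have [|l [_ Hl]] := @segment_compact R (- M) M (u ^~ t @ G)
    (fmap_proper_filter (u ^~ t) PG).
    change (G [set n | u n t \in `[- M, M]]); apply: filterS HM => n.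
    by rewrite /= in_itv/= -ler_norml.
  exists l => e e0.
  have [//|HC] := in_ultra_setVsetC [set n | `|u n t - l| < e] UG.
  have [//||x [/= x1 x2]] := Hl [set x | ~ `|x - l| < e] (ball l e).
    exact: nbhsx_ballx.
  by exfalso; apply: x1; rewrite distrC.
have [v vP] := choice lim.
have equv A e : 0 < e -> exists2 d, 0 < d & forall s t, `|s| <= A -> `|t| <= A ->
    `|s - t| < d -> `|v s - v t| < e.
  move=> e0; have e30 : 0 < e / 3 by rewrite divr_gt0.
  have [d d0 /ooG Hd] := equ A _ e30; exists d => // s t sA tA st.
  have [n [[H1 H2] H3]] := filter_ex (filterI (filterI (vP s _ e30) (vP t _ e30)) Hd).
  have {}H3 := H3 s t sA tA st.
  move: H1 H2 H3; rewrite !ltr_norml => /andP[? ?] /andP[? ?] /andP[? ?].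
  by apply/andP; split; lra.
exists G, v; split => //.
  move=> t; apply/cvgrPdist_lt => e e0; have [d d0 Hd] := equv (`|t| + 1) e e0.
  near=> s; apply: Hd; first by rewrite lerDl.
    have : `|t - s| < 1 by near: s; exact: cvgr_dist_lt.
    move=> ts; rewrite -[s](subrK t) addrC (le_trans (ler_normD _ _))// lerD2l.
    by rewrite distrC ltW.
  by near: s; exact: cvgr_dist_lt.
move=> A e e0; have e30 : 0 < e / 3 by rewrite divr_gt0.
have [d1 d10 /ooG H1] := equ (A + 1) _ e30.
have [d2 d20 H2] := equv (A + 1) _ e30.
have cA := @segment_compact R (- A) A.
have : \forall n \near G, `[(- A), A]%classic `<=` [set t | `|u n t - v t| < e].
  apply: ((compact_near_coveringP _).1 cA _ G
    (fun n => [set t | `|u n t - v t| < e]) _) => t.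
  rewrite /= in_itv/= -ler_norml => tA.
  have : \forall t' \near t & n \near G, [/\ `|t - t'| < Num.min 1 (Num.min d1 d2),
     `|u n t - v t| < e / 3 & (forall s t, `|s| <= A + 1 -> `|t| <= A + 1 ->
       `|s - t| < d1 ->
      `|u n s - u n t| < e / 3)].
    have m0 : 0 < Num.min 1 (Num.min d1 d2) by rewrite !lt_min ltr01 d10 d20.
    have ball_t : \forall t' \near t, `|t - t'| < Num.min 1 (Num.min d1 d2).
      by near=> t'; near: t'; exact: cvgr_dist_lt.
    exists ([set t' | `|t - t'| < Num.min 1 (Num.min d1 d2)],
      [set n | `|u n t - v t| < e / 3] `&`
      [set n | forall s t, `|s| <= A + 1 -> `|t| <= A + 1 -> `|s - t| < d1 ->
        `|u n s - u n t| < e / 3]).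
      by split => //=; apply: filterI => //; exact: vP.
    by move=> [t' n] /= [? []].
  apply: filterS => -[t' n] /= [tt' H3 H4].
  move: tt'; rewrite !lt_min => /andP[tt1 /andP[ttd1 ttd2]].
  have tA1 : `|t| <= A + 1 by rewrite (le_trans tA)// lerDl.
  have t'A1 : `|t'| <= A + 1.
    rewrite -[t'](subrK t) addrC (le_trans (ler_normD _ _))// lerD//.
    by rewrite distrC ltW.
  have := H4 t t' tA1 t'A1 ttd1; have := H2 t t' tA1 t'A1 ttd2; move: H3.
  rewrite !ltr_norml => /andP[? ?] /andP[? ?] /andP[? ?].
  by apply/andP; split; lra.
by apply: filterS => n H t tA; apply: H; rewrite /= in_itv/= -ler_norml.
Unshelve. all: by end_near. Qed.

(** Shifting equicontinuous functions by vanishing delays does not change their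
    limit. *)
Lemma compact_cvg_delay (R : realType) (u : nat -> R -> R)
  (h : nat -> R) (G : set_system nat) (v : R -> R) :
  Filter G -> \oo `<=` G -> loc_equicontinuous u -> h n @[n --> \oo] --> 0 ->
  compact_cvg G u v -> compact_cvg G (fun n => delay (h n) (u n)) v.
Proof.
move=> FG ooG equ h0 uv A e e0; have e20 : 0 < e / 2 by rewrite divr_gt0.
have [d d0 /ooG H1] := equ (A + 1) _ e20.
have H2 := uv A _ e20.
have : \forall n \near \oo, `|h n| < Num.min 1 d.
  have m0 : 0 < Num.min 1 d by rewrite lt_min ltr01.
  have /cvgrPdist_lt/(_ _ m0) := h0; apply: filterS => n; rewrite sub0r normrN.
  exact.
move=> /ooG H3; apply: filterS3 H1 H2 H3 => n H1 H2 H3 t tA.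
move: H3; rewrite lt_min => /andP[hn1 hnd].
rewrite /delay; have := H2 t tA.
have H : `|u n (t - h n) - u n t| < e / 2.
  apply: H1; first by rewrite (le_trans (ler_normB _ _))// lerD// ltW.
    by rewrite (le_trans tA)// lerDl.
  by rewrite addrAC subrr sub0r normrN.
move: H; rewrite !ltr_norml => /andP[? ?] /andP[? ?].
by apply/andP; split; lra.
Qed.

(** * Linear, positive and causal operators *)

Section operators.
Variable R : realType.
Implicit Types (T : (R -> R) -> R -> R) (u v w : R -> R).

Lemma continuous_const (k : R) : continuous (fun _ : R => k).
Proof. by move=> t; exact: cvg_cst. Qed.

(** Homogeneity is the instance [v = 0] of linearity, once [T 0 = 0] has been
    read off from [T 0 = T 0 + T 0]. *)
Lemma linear_operator_cst T k : linear_operator T ->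
  {ae leb, forall t : R, T (fun=> k) t = k * T (fun=> 1) t}.
Proof.
move=> lT.
have Z := lT 1 _ _ (@continuous_const 0) (@continuous_const 0).
have K := lT k _ _ (@continuous_const 1) (@continuous_const 0).
apply: filterS2 Z K => t.
have -> : (fun s : R => 1 * 0 + 0) = (fun=> 0 : R).
  by apply/funext => s; rewrite mulr0 addr0.
have -> : (fun s : R => k * 1 + 0) = (fun=> k : R).
  by apply/funext => s; rewrite mulr1 addr0.
by rewrite mul1r => /esym/eqP; rewrite -subr_eq0 addrK => /eqP-> ->; rewrite addr0.
Qed.

Lemma linear_operator0 T : linear_operator T ->
  {ae leb, forall t : R, T (fun=> 0) t = 0}.
Proof.
by move=> lT; apply: filterS (linear_operator_cst 0 lT) => t; rewrite mul0r.
Qed.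

Lemma V_causal T : V T -> causal T.
Proof. by move=> VT z u v cu cv uv; apply: (VT z).2 => //. Qed.

Lemma theta_continuous (b : R) u : continuous u -> continuous (theta b u).
Proof.
move=> cu t; apply: (@continuous_comp _ _ _ (fun s => Num.min s b) u); last exact: cu.
by apply: (@continuous_min R R id (fun=> b) t); [exact: cvg_id|exact: cvg_cst].
Qed.

Lemma thetaE (b t : R) u : t <= b -> theta b u t = u t.
Proof. by move=> tb; rewrite /theta min_l. Qed.

Lemma theta_le (b t : R) w : (forall s t, s <= t -> w s <= w t) -> theta b w t <= w b.
Proof. by move=> nd; apply: nd; rewrite ge_min lexx orbT. Qed.

(** Statements about Volterra operators come one half-line at a time. *)
Lemma ae_half_lines (P : R -> Prop) :
  (forall n : nat, {ae leb, forall t : R, t <= n%:R -> P t}) ->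
    {ae leb, forall t : R, P t}.
Proof.
move=> H; have := ae_foralln H; apply: filterS => t Pt.
apply: (Pt (Num.bound `|t|)).
by rewrite (le_trans (ler_norm t))// ltW// archi_boundP.
Qed.

(** The condition defining P+ concerns functions frozen after a time; a causal
    operator does not see the freezing before that time. *)
Lemma Pplus_ge0 T : Pplus T -> causal T -> positive_on_nondecreasing T.
Proof.
move=> PT cT w ACw w0 nd; apply: ae_half_lines => n.
have [_ _ /(_ w)] := PT n%:R.
have cw := ACloc_continuous ACw.
move=> /(_ _ (fun t _ => w0 t) (fun s t st _ => nd s t st))=> H.
have {}H : {ae leb, forall t : R, t <= n%:R -> 0 <= T (theta n%:R w) t}.
  by apply: H => a b ab _; apply: ACw.
have E := cT n%:R _ _ (@theta_continuous n%:R _ cw) cw (fun t tn => thetaE w tn).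
by apply: filterS2 H E => t H E tn; rewrite -E// H.
Qed.

(** Up to time [b] the operator sees [w] through [theta b w], which lies below the
    constant [w b]. *)
Lemma positive_operator_le T w (b : R) : linear_operator T -> positive_operator T ->
  causal T -> continuous w -> (forall s t, s <= t -> w s <= w t) ->
  {ae leb, forall t : R, t <= b -> T w t <= w b * T (fun=> 1) t}.
Proof.
move=> lT pT cT cw nd.
have ct := @theta_continuous b _ cw.
have E := cT b _ _ ct cw (fun t tb => thetaE w tb).
have K := linear_operator_cst (w b) lT.
have L := lT (-1) _ _ ct (@continuous_const (w b)).
have cd : continuous (fun s => -1 * theta b w s + w b).
  move=> t; apply: cvgD; last exact: cvg_cst.
  by apply: cvgM; [exact: cvg_cst|exact: ct].
have P := pT _ cd.
have {}P : {ae leb, forall t : R, 0 <= T (fun s => -1 * theta b w s + w b) t}.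
  by apply: P => t; rewrite mulN1r addrC subr_ge0; exact: theta_le.
have EK : {ae leb, forall t : R, t <= b -> T (theta b w) t = T w t /\
   T (fun=> w b) t = w b * T (fun=> 1) t}.
  by apply: filterS2 E K => t E K tb; split => //; exact: E.
apply: filterS3 EK L P => t EK L P tb; have [E' K'] := EK tb.
by move: P; rewrite L K' E' mulN1r addrC subr_ge0.
Qed.

Lemma sup_norm_le v (m : R) : (forall t, `|v t| <= m) ->
  (sup_norm v <= m%:E)%E /\ 0 <= fine (sup_norm v) <= m.
Proof.
move=> vm; have H : (sup_norm v <= m%:E)%E.
  by apply: ge_ereal_sup => _ [t _ <-]; rewrite lee_fin.
have H0 : (0 <= sup_norm v)%E.
  apply: (@le_trans _ _ `|v 0|%:E); first by rewrite lee_fin.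
  by apply: ereal_sup_ubound; exists 0.
split => //; move: H H0; case: (sup_norm v) => [r| |] //=.
by rewrite !lee_fin => -> ->.
Qed.

Lemma causalD T T' : causal T -> causal T' -> causal (fun u t => T u t + T' u t).
Proof.
move=> cT cT' z u v cu cv uv; apply: filterS2 (cT z u v cu cv uv) (cT' z u v cu cv uv).
by move=> t H H' tz; rewrite H// H'.
Qed.

Lemma causalB T T' : causal T -> causal T' -> causal (fun u t => T u t - T' u t).
Proof.
move=> cT cT' z u v cu cv uv; apply: filterS2 (cT z u v cu cv uv) (cT' z u v cu cv uv).
by move=> t H H' tz; rewrite H// H'.
Qed.

Lemma causal_trunc T (t0 k : R) : causal T -> causal (fun u => T (trunc t0 k u)).
Proof.
move=> cT z u v cu cv uv; apply: cT; [exact: trunc_continuous|exact: trunc_continuous|].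
by move=> t tz; rewrite /trunc !uv// (le_trans _ tz)// ge_min lexx.
Qed.

Lemma trunc_id w (t0 k : R) : (forall t, t <= t0 -> w t <= k) -> trunc t0 k w = w.
Proof.
move=> wk; apply/funext => t; rewrite /trunc max_r ?subr0//.
by rewrite subr_le0 wk// ge_min lexx orbT.
Qed.

Lemma trunc_left w (t0 k t : R) : t <= t0 -> trunc t0 k w t = Num.min (w t) k.
Proof.
move=> tt0; rewrite /trunc (min_l tt0) /Num.min /Num.max.
by case: ltP => ?; case: ltP => ?; lra.
Qed.

Lemma trunc_bounds w (t0 k t : R) : 0 <= k -> (forall s t, s <= t -> w s <= w t) ->
  (forall t, 0 <= w t) -> 0 <= trunc t0 k w t <= w t.
Proof.
move=> k0 nd w0; rewrite /trunc.
have H : w (Num.min t t0) <= w t by apply: nd; rewrite ge_min lexx.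
have H0 := w0 (Num.min t t0); rewrite /Num.max; case: ltP => ?; apply/andP; split; lra.
Qed.

End operators.

(** * A priori estimates and passage to the limit *)

(** The linear part of the growth costs [ut / 2] and the sublinear part
    [ut / 4 + X]; together they leave a quarter of [ut] on the left-hand side. *)
Lemma absorb_half_quarter (R : realFieldType) (us ut Y Q Q' X : R) :
  ut - us <= Y + Q -> Q <= Q' -> Y <= ut * (1 / 2) -> Q' <= ut / 4 + X ->
  ut <= 4 * us + 4 * X.
Proof. by lra. Qed.

Lemma three_eps (R : realFieldType) (x y a b I e : R) :
  `|x - a| < e / 3 -> `|y - b| < e / 3 -> `|(y - x) - I| < e / 3 ->
  `|(b - a) - I| < e.
Proof.
rewrite !ltr_norml => /andP[? ?] /andP[? ?] /andP[? ?].
by apply/andP; split; lra.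
Qed.

Section estimates.
Variables (R : realType) (l0 l1 f : (R -> R) -> R -> R).
Hypotheses (l0_lin : linear_operator l0) (l0_pos : positive_operator l0)
  (l1_lin : linear_operator l1) (l1_pos : positive_operator l1)
  (l0V : V l0) (l1V : V l1) (fV : V f)
  (l01P : Pplus (fun u t => l0 u t - l1 u t)) (f_Car : local_Caratheodory f).
Variables (t0 kappa : R) (q : R -> R -> R).
Hypotheses (f0 : {ae leb, forall t : R, t <= t0 -> f (fun=> 0) t = 0})
  (kappa_gt0 : 0 < kappa)
  (H1 : forall v : R -> R, C0 `[0, kappa] v ->
     {ae leb, forall t : R, t <= t0 -> 0 <= f v t})
  (qK : Kloc t0 q)
  (q_nd : forall t x y : R, t0 <= t -> 0 <= x -> x <= y -> q t x <= q t y)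
  (q_lim : forall b : R, t0 < b ->
     (x^-1 * \int[leb]_(s in `[t0, b]) q s x) @[x --> +oo] --> (0 : R))
  (H2 : forall v : R -> R, C0 `[0, +oo[ v ->
     (forall t : R, t <= t0 -> v t <= kappa) ->
     {ae leb, forall t : R, t0 <= t ->
        0 <= f v t /\ f v t <= q t (fine (sup_norm v))}).

Let F (w : R -> R) t := l0 w t - l1 w t + f (trunc t0 kappa w) t.

Lemma rhs_mean_continuous : mean_continuous F.
Proof.
apply: mean_continuousD; last first.
  by apply: mean_continuous_trunc; exact/continuous_operator_mean/(fV 0).1.
by apply: mean_continuousB; apply: continuous_operator_mean;
  [exact: (l0V 0).1|exact: (l1V 0).1].
Qed.

Lemma rhs_causal : causal F.
Proof.
by apply: causalD; [apply: causalB|apply: causal_trunc]; exact: V_causal.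
Qed.

Lemma rhs_zero : {ae leb, forall t : R, t <= t0 -> F (fun=> 0) t = 0}.
Proof.
have tz : trunc t0 kappa (fun=> 0) = fun=> 0 by apply: trunc_id => t _; exact: ltW.
apply: filterS3 (linear_operator0 l0_lin) (linear_operator0 l1_lin) f0 => t e0 e1 ef tt0.
by rewrite /F tz e0 e1 ef// subr0 addr0.
Qed.

Lemma bounded_by (v : R -> R) (m : R) : (forall t, `|v t| <= m) ->
  [bounded v t | t in [set: R]].
Proof.
move=> vm; exists m; split; first exact: num_real.
by move=> x mx t _ /=; exact: le_trans (vm t) (ltW mx).
Qed.

Section admissible.
Variables (w : R -> R).
Hypotheses (cw : continuous w) (w_nd : forall s t, s <= t -> w s <= w t)
  (w_ge0 : forall t, 0 <= w t).
Let k0 := ltW kappa_gt0.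

Lemma theta_trunc_bounds b t : 0 <= theta b (trunc t0 kappa w) t <= w b.
Proof.
have /andP[-> /=] := trunc_bounds t0 (Num.min t b) k0 w_nd w_ge0.
by move=> H; apply: (le_trans H); apply: w_nd; rewrite ge_min lexx orbT.
Qed.

Lemma theta_trunc_norm b t : `|theta b (trunc t0 kappa w) t| <= w b.
Proof. by have /andP[a0 a1] := theta_trunc_bounds b t; rewrite ger0_norm. Qed.

Lemma f_theta_trunc_ae b : {ae leb, forall t : R, t <= b ->
  f (theta b (trunc t0 kappa w)) t = f (trunc t0 kappa w) t}.
Proof.
have ct := @trunc_continuous _ t0 kappa _ cw.
by apply: (V_causal fV) => //; [exact: theta_continuous|move=> t; exact: thetaE].
Qed.

(** The sign and growth conditions on [f] concern bounded functions, so they are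
    applied to [trunc w] frozen after [b]. *)
Lemma f_trunc_right b : {ae leb, forall t : R, t0 <= t -> t <= b ->
  0 <= f (trunc t0 kappa w) t <= q t (w b)}.
Proof.
have [sn /andP[sn0 snb]] := sup_norm_le (theta_trunc_norm b).
have H : {ae leb, forall t : R, t0 <= t -> 0 <= f (theta b (trunc t0 kappa w)) t /\
   f (theta b (trunc t0 kappa w)) t <= q t (fine
     (sup_norm (theta b (trunc t0 kappa w))))}.
  apply: H2.
    split.
    - by apply: theta_continuous; exact: trunc_continuous.
    - exact: bounded_by (theta_trunc_norm b).
    - by move=> t /=; rewrite in_itv/= andbT; have /andP[] := theta_trunc_bounds b t.
  move=> t tt0; have mt0 : Num.min t b <= t0 by rewrite ge_min tt0.
  by rewrite /theta (trunc_left _ _ mt0) ge_min lexx orbT.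
apply: filterS2 H (f_theta_trunc_ae b) => t H E t0t tb.
have [Ha Hb] := H t0t; rewrite -E// Ha/=; apply: (le_trans Hb).
exact: q_nd.
Qed.

(** On the left of [t0] the truncation coincides with [min (w t) kappa], a
    function with values in [[0, kappa]] on the whole line. *)
Lemma f_trunc_ge0 : {ae leb, forall t : R, 0 <= f (trunc t0 kappa w) t}.
Proof.
pose v t := Num.min (w t) kappa.
have cv : continuous v.
  by move=> t; apply: (@continuous_min R R w (fun=> kappa) t); [exact: cw|exact: cvg_cst].
have vb t : 0 <= v t <= kappa.
  by rewrite /v ge_min lexx orbT le_min w_ge0 k0.
have L : {ae leb, forall t : R, t <= t0 -> 0 <= f v t}.
  apply: H1; split => //; apply: (@bounded_by v kappa) => t.
  by have /andP[a0 a1] := vb t; rewrite ger0_norm.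
have E : {ae leb, forall t : R, t <= t0 -> f (trunc t0 kappa w) t = f v t}.
  apply: (V_causal fV) => //; first exact: trunc_continuous.
  by move=> t tt0; rewrite trunc_left.
apply: ae_half_lines => n; apply: filterS3 L E (f_trunc_right n%:R) => t L E Rt tn.
have [tt0|/ltW t0t] := leP t t0; first by rewrite E// L.
by have /andP[] := Rt t0t tn.
Qed.

(** The contribution of [l1] is dropped by positivity. *)
Lemma rhs_le_linear b :
  {ae leb, forall t : R, t <= b ->
    F w t <= w b * `|l0 (fun=> 1) t| + f (trunc t0 kappa w) t}.
Proof.
have A := @positive_operator_le _ l0 w b l0_lin l0_pos (V_causal l0V) cw w_nd.
apply: filterS2 A (l1_pos cw w_ge0) => t Ha Hb tb.
have := Ha tb; have := ler_wpM2l (w_ge0 b) (ler_norm (l0 (fun=> 1) t)).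
by rewrite /F; lra.
Qed.

End admissible.

Lemma rhs_positive_on_nondecreasing : positive_on_nondecreasing F.
Proof.
move=> w ACw w0 nd; have cw := ACloc_continuous ACw.
have L : {ae leb, forall t : R, 0 <= l0 w t - l1 w t}.
  by apply: (Pplus_ge0 l01P) => //; apply: causalB; exact: V_causal.
by apply: filterS2 L (f_trunc_ge0 cw nd w0) => t Ha Hb; rewrite /F addr_ge0.
Qed.

Lemma l0_Lloc1 : Lloc (l0 (fun=> 1)).
Proof. by apply: (l0V 0).1.1; exact: continuous_const. Qed.

Lemma q_integrable b x : 0 <= x -> leb.-integrable `[t0, b] (EFin \o q ^~ x).
Proof.
move=> x0; have [_ _ _ /(_ [set x])] := qK.
have E : (fun t : R => ereal_sup [set (q t x0)%:E | x0 in [set x]]) = EFin \o q ^~ x.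
  by apply/funext => t; rewrite image_set1 ereal_sup1.
rewrite E; apply => //; [exact: compact_set1|by exists x|].
by move=> _ -> /=; rewrite in_itv/= x0.
Qed.

(** Sublinearity at infinity and monotonicity in [x] give an affine bound with any
    positive slope. *)
Lemma q_sublinear b : t0 < b -> exists2 X : R, 0 <= X &
  forall x, 0 <= x -> \int[leb]_(s in `[t0, b]) q s x <= x / 4 + X.
Proof.
move=> t0b; have /cvgrPdist_lt/(_ (1 / 4)) := q_lim t0b.
case => [|M [_ HM]]; first by rewrite divr_gt0.
pose N := Num.max M 0 + 1.
have N0 : 0 < N by rewrite /N ltr_wpDl// le_max lexx orbT.
have MN : M < N by rewrite /N ltr_pwDr// le_max lexx.
have mI := @measurable_itv_leb R `[t0, b].
have big x : M < x -> 0 < x -> \int[leb]_(s in `[t0, b]) q s x <= x / 4.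
  move=> Mx x0; have := HM x Mx; rewrite sub0r normrN => /(le_lt_trans (ler_norm _)).
  by rewrite ltr_pdivrMl// => /ltW; rewrite mul1r.
exists (N / 4); first by apply: divr_ge0 => //; exact: ltW.
move=> x x0; have [Nx|xN] := ltP N x.
  by have := big x (lt_trans MN Nx) (lt_trans N0 Nx); lra.
have : \int[leb]_(s in `[t0, b]) q s x <= \int[leb]_(s in `[t0, b]) q s N.
  apply: le_Rintegral => //; [exact: q_integrable|apply: q_integrable; exact: ltW|].
  by move=> s /=; rewrite in_itv/= => /andP[t0s _]; exact: q_nd.
by have := big N MN N0; lra.
Qed.

Record delayed (a h b c : R) (u : R -> R) : Prop := Delayed {
  delayed_AC : ACloc [set: R] u;
  delayed_nd : forall s t, s <= t -> u s <= u t;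
  delayed_ge0 : forall t, 0 <= u t;
  delayed_t0 : u t0 = c;
  delayed_eq : forall s t, a <= s -> s <= t -> t <= b ->
      u t - u s = \int[leb]_(r in `]s, t]) F (delay h u) r }.

(** The linear growth is proportional to the value at the right end [t]; when the
    integral of [l0 1] is at most 1/2 it can be absorbed into the left-hand side. *)
Lemma delayed_step a h b c u s t X : delayed a h b c u -> a <= t0 -> 0 <= h ->
  t0 <= s -> s <= t -> t <= b ->
  (forall x, 0 <= x -> \int[leb]_(s in `[t0, b]) q s x <= x / 4 + X) ->
  \int[leb]_(r in `]s, t]) `|l0 (fun=> 1) r| < 1 / 2 ->
  u t <= 4 * u s + 4 * X.
Proof.
move=> [AC nd ge0 _ eq] at0 h0 t0s st tb HX Hl.
have cw : continuous (delay h u) by apply: delay_continuous; exact: ACloc_continuous.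
have w_nd x y : x <= y -> delay h u x <= delay h u y.
  by move=> xy; apply: nd; rewrite lerD2r.
have w0 x : 0 <= delay h u x by exact: ge0.
have wu : delay h u t <= u t by apply: nd; rewrite gerBl.
have mI := @measurable_itv_leb R `]s, t].
have H : {ae leb, forall r : R, r \in `]s, t] ->
  F (delay h u) r <= u t * `|l0 (fun=> 1) r| + q r (u t)}.
  apply: filterS2 (rhs_le_linear cw w_nd w0 t) (f_trunc_right cw w_nd w0 t) => r Ha Hb.
  rewrite in_itv/= => /andP[sr rt]; have t0r : t0 <= r by rewrite (le_trans t0s)// ltW.
  have /andP[_ Hb'] := Hb t0r rt.
  apply: (le_trans (Ha rt)); apply: lerD; first by rewrite ler_wpM2r.
  by apply: (le_trans Hb'); exact: q_nd.
have iq0 := q_integrable b (ge0 t).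
have sub : `]s, t]%classic `<=` `[t0, b]%classic.
  by move=> r /=; rewrite !in_itv/= => /andP[sr rt];
    rewrite (le_trans t0s (ltW sr)) (le_trans rt tb).
have iq : leb.-integrable `]s, t] (EFin \o q ^~ (u t)).
  by apply: integrableS iq0 => //; exact: measurable_itv_leb.
have qle : \int[leb]_(r in `]s, t]) q r (u t) <= \int[leb]_(r in `[t0, b]) q r (u t).
  rewrite /Rintegral; apply: fine_le.
  - exact: integrable_fin_num.
  - by apply: integrable_fin_num => //; exact: measurable_itv_leb.
  - apply: ge0_subset_integral; last exact: sub.
    + exact: measurable_itv_leb.
    + exact: measurable_itv_leb.
    + exact: (measurable_int _ iq0).
    + by move=> r /=; rewrite in_itv/= lee_fin => /andP[t0r _];
        case: qK => q0 _ _ _; exact: q0.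
have L1 := Lloc_norm l0_Lloc1.
have il := Lloc_itv false false s t L1.
have : u t - u s <= \int[leb]_(r in `]s, t]) (u t * `|l0 (fun=> 1) r| + q r (u t)).
  rewrite eq//; first last.
    exact: le_trans t0s.
  apply: ae_le_Rintegral => //.
  - by apply: Lloc_itv; apply: rhs_mean_continuous.1.
  - apply: (integrableD mI (Lloc_itv _ _ _ _ (LlocZ (u t) L1)) iq).
rewrite RintegralD//; last first.
  by apply: Lloc_itv; exact: LlocZ.
rewrite RintegralZl//.
move=> {}eq; apply: (absorb_half_quarter eq qle) (HX _ (ge0 t)).
by rewrite ler_wpM2l// ltW.
Qed.

(** Independence of the starting point [a] and of the delay is what lets [a] go
    to minus infinity and the delay to 0. *)
Lemma delayed_bounded b c : t0 < b -> c <= kappa -> exists M : R,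
  forall a h u, delayed a h b c u -> a <= t0 -> 0 <= h -> u b <= M.
Proof.
move=> t0b ck; have [X X0 HX] := q_sublinear t0b.
have e0 : 0 < 1 / 2 :> R by rewrite divr_gt0.
have [d d0 Hd] := Rintegral_small t0 b l0_Lloc1 e0.
(* Cut [[t0, b]] into [N] intervals shorter than [d]. *)
pose N := (Num.bound `|(b - t0) / d|).+1.
pose p i : R := t0 + (b - t0) / N%:R *+ i.
have N0 : 0 < N%:R :> R by rewrite ltr0n.
have st0 : 0 <= (b - t0) / N%:R by rewrite divr_ge0// ?subr_ge0 ltW.
have std : (b - t0) / N%:R < d.
  rewrite ltr_pdivrMr// mulrC -ltr_pdivrMr//; apply: (le_lt_trans (ler_norm _)).
  apply: (lt_trans (archi_boundP (normr_ge0 _))).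
  by rewrite ltr_nat.
have pN : p N = b by rewrite /p -mulr_natr divfK ?gt_eqF// addrC subrK.
have pS i : p i.+1 = p i + (b - t0) / N%:R by rewrite /p mulrSr addrA.
have p0 i : t0 <= p i by rewrite /p lerDl mulrn_wge0.
have pb i : (i <= N)%N -> p i <= b.
  by move=> iN; rewrite -pN /p lerD2l ler_wpMn2l.
(* One application of [delayed_step] on each of the [N] intervals. *)
exists (iter N (fun m => 4 * m + 4 * X) kappa) => a h u du at0 h0; rewrite -[b in u b]pN.
have : (N <= N)%N by [].
elim: {-2}N => [_|i IH iN]; first by rewrite /p mulr0n addr0 (delayed_t0 du).
have pp : p i <= p i.+1 by rewrite pS lerDl.
have H : u (p i.+1) <= 4 * u (p i) + 4 * X.
  apply: (delayed_step du at0 h0 (p0 i) pp (pb _ iN) HX); apply: Hd.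
  - exact: measurable_itv_leb.
  - move=> r /=; rewrite !in_itv/= => /andP[pr rp].
    by rewrite (le_trans (p0 i) (ltW pr)) (le_trans rp (pb _ iN)).
  - by rewrite leb_itv// lte_fin pS addrC addKr.
by apply: (le_trans H) => /=; rewrite lerD2r ler_wpM2l// IH// ltnW.
Qed.

(** Below the bound [M] the local Carathéodory condition controls [f], so that the
    derivatives have a common locally integrable majorant [g]. *)
Lemma delayed_modulus b M : 0 <= M -> exists2 g : R -> R, Lloc g &
  forall a h c u, delayed a h b c u -> 0 <= h -> u b <= M ->
  forall s t, a <= s -> s <= t -> t <= b -> u t - u s <= \int[leb]_(r in `]s, t]) g r.
Proof.
move=> M0; have M10 : 0 < M + 1 by rewrite ltr_wpDl.
have [r [Lr r0 Hr]] := f_Car M10.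
have L1 := Lloc_norm l0_Lloc1.
have Lg : Lloc (fun t => M * `|l0 (fun=> 1) t| + r t) by apply: LlocD => //; exact: LlocZ.
exists (fun t => M * `|l0 (fun=> 1) t| + r t) => // a h c u [AC nd ge0 _ eq] h0 uM s
  t as_ st tb.
rewrite eq//.
have cw : continuous (delay h u) by apply: delay_continuous; exact: ACloc_continuous.
have w_nd x y : x <= y -> delay h u x <= delay h u y.
  by move=> xy; apply: nd; rewrite lerD2r.
have w0 x : 0 <= delay h u x by exact: ge0.
have wM : delay h u b <= M by apply: le_trans uM; apply: nd; rewrite gerBl.
apply: ae_le_Rintegral.
- exact: measurable_itv_leb.
- by apply: Lloc_itv; apply: rhs_mean_continuous.1.
- exact: Lloc_itv.
have [sn _] := sup_norm_le (theta_trunc_norm w_nd w0 b).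
have Hf : {ae leb, forall t : R, `|f (theta b (trunc t0 kappa (delay h u))) t| <= r t}.
  apply: Hr; first by apply: theta_continuous; exact: trunc_continuous.
  apply: (le_trans sn); rewrite lee_fin (le_trans wM)// lerDl.
  exact: ler01.
apply: filterS3 (rhs_le_linear cw w_nd w0 b) (f_theta_trunc_ae cw b) Hf => x Ha Hb Hc.
rewrite /= in_itv/= => /andP[_ xt]; have xb := le_trans xt tb.
apply: (le_trans (Ha xb)); apply: lerD; first by rewrite ler_wpM2r.
by rewrite -Hb//; apply: le_trans Hc; exact: ler_norm.
Qed.

(** The delayed solutions on [[- n, n]] with delay [1 / (n + 1)] converge, and
    the integral equation survives in the limit. *)
Lemma limit_solution c : 0 <= c <= kappa -> exists v : R -> R,
  [/\ continuous v, forall s t, s <= t -> v s <= v t, forall t, 0 <= v t, v t0 = c &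
    forall s t, s <= t -> v t - v s = \int[leb]_(r in `]s, t]) F v r].
Proof.
move=> /andP[c0 ck].
pose h n : R := n.+1%:R^-1.
have h0 n : 0 < h n by rewrite invr_gt0 ltr0n.
have ex n : exists u, delayed (- n%:R) (h n) n%:R c u.
  have [u [? ? ? ? ?]] := delayed_solution (- n%:R) n%:R rhs_mean_continuous
    rhs_causal rhs_positive_on_nondecreasing rhs_zero (h0 n) c0.
  by exists u; split.
have [u uP] := choice ex.
have large b : \forall n \near \oo, b <= n%:R :> R by exact: nbhs_infty_ger.
have shrink b n : b <= n%:R -> delayed (- n%:R) (h n) b c (u n).
  move=> bn; case: (uP n) => AC nd ge0 ut0 eq; split => // s t as_ st tb.
  by apply: eq => //; exact: le_trans bn.
have bounds A : exists M b, [/\ 0 <= M, A <= b, t0 < b & \forall n \near \oo,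
   delayed (- n%:R) (h n) b c (u n) /\ u n b <= M].
  pose b := `|A| + `|t0| + 1.
  have t0b : t0 < b by have := ler_norm t0; have := normr_ge0 A; rewrite /b; lra.
  have Ab : A <= b by have := ler_norm A; have := normr_ge0 t0; rewrite /b; lra.
  have [M HM] := delayed_bounded t0b ck.
  exists (Num.max M 0), b; split => //; first by rewrite le_max lexx orbT.
  apply: filterS2 (large b) (large (- t0)) => n bn t0n; have D := shrink _ _ bn.
  split => //; rewrite le_max (HM _ _ _ D) //; last exact: ltW.
  by rewrite lerNl.
have equ : loc_equicontinuous u.
  move=> A e e0; have [M [b [M0 Ab t0b Hb]]] := bounds A.
  have [g Lg Hg] := delayed_modulus b M0.
  have [d d0 Hd] := Rintegral_small (- A) A Lg e0.
  exists d => //; apply: filterS2 Hb (large A) => n [D uM] An.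
  have aux s t : `|s| <= A -> `|t| <= A -> s <= t -> `|s - t| < d -> `|u n s - u n t| < e.
    rewrite !ler_norml => /andP[As sA] /andP[At tA] st std.
    rewrite distrC ger0_norm ?subr_ge0 ?(delayed_nd D)//.
    have an : - n%:R <= s by rewrite (le_trans _ As)// lerN2.
    apply: (le_lt_trans (Hg _ _ _ _ D (ltW (h0 n)) uM s t an st (le_trans tA Ab))).
    have mI := @measurable_itv_leb R `]s, t].
    have sub : `]s, t]%classic `<=` `[(- A), A]%classic.
      by move=> r /=; rewrite !in_itv/= => /andP[sr rt];
        rewrite (le_trans As (ltW sr)) (le_trans rt tA).
    have small : (leb `]s, t] < d%:E)%E.
      by rewrite leb_itv// lte_fin; move: std; rewrite distrC ger0_norm// subr_ge0.
    apply: le_lt_trans (Hd _ mI sub small); apply: (le_trans (ler_norm _)).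
    by apply: le_normr_Rintegral => //; exact: Lloc_itv.
  move=> s t sA tA std; have [st|/ltW ts] := leP s t; first exact: aux.
  by rewrite distrC; apply: aux => //; rewrite distrC.
have bdd t : exists M, \forall n \near \oo, `|u n t| <= M.
  have [M [b [M0 tb t0b Hb]]] := bounds t; exists M.
  apply: filterS Hb => n [D uM]; rewrite ger0_norm ?(delayed_ge0 D)//.
  by apply: le_trans uM; exact: (delayed_nd D).
have [G [v [PG ooG cv uv]]] := loc_equicontinuous_limit equ bdd.
have FG : Filter G by exact: filter_filter.
have hto0 : h n @[n --> \oo] --> 0 by exact: cvg_harmonic.
have wv := compact_cvg_delay FG ooG equ hto0 uv.
have pt t e : 0 < e -> \forall n \near G, `|u n t - v t| < e.
  by move=> e0; apply: filterS (uv `|t| e e0) => n; apply.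
exists v; split => //.
- move=> s t st; apply/ler_addgt0Pr => e e0; have e20 : 0 < e / 2 by rewrite divr_gt0.
  have [n [Hs Ht]] := filter_ex (filterI (pt s _ e20) (pt t _ e20)).
  have := delayed_nd (uP n) st; move: Hs Ht; rewrite !ltr_norml => /andP[? ?]
    /andP[? ?]; lra.
- move=> t; apply/ler_addgt0Pr => e e0; have [n Ht] := filter_ex (pt t e e0).
  have := delayed_ge0 (uP n) t; move: Ht; rewrite !ltr_norml => /andP[? ?]; lra.
- apply/eqP; rewrite eq_sym -subr_eq0 -normr_le0; apply/ler_addgt0Pr => e e0.
  have [n Ht] := filter_ex (pt t0 e e0); move: Ht;
    rewrite (delayed_t0 (uP n)) add0r; exact: ltW.
- move=> s t st; apply/eqP; rewrite -subr_eq0 -normr_le0; apply/ler_addgt0Pr => e e0.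
  have e30 : 0 < e / 3 by rewrite divr_gt0.
  have cw n : continuous (delay (h n) (u n)).
    by apply: delay_continuous; apply: ACloc_continuous; exact: delayed_AC (uP n).
  have HF := rhs_mean_continuous.2 _ _ _ _ FG cw cv wv.
  have HI := mean_cvg_Rintegral FG (fun n => rhs_mean_continuous.1 _ (cw n))
    (rhs_mean_continuous.1 _ cv) HF s t e30.
  have [n [[[[Hs Ht] Hint] sn] tn]] := filter_ex (filterI (filterI (filterI (filterI
    (pt s _ e30) (pt t _ e30)) HI) (ooG _ (large (- s)))) (ooG _ (large t))).
  have ns : - n%:R <= s by rewrite lerNl.
  rewrite add0r; apply: ltW; move: (Hint s t (lexx _) (lexx _)).
  rewrite -(delayed_eq (uP n) ns st tn); exact: three_eps.
Qed.

End estimates.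

Unset Implicit Arguments.
Set Strict Implicit.

Theorem theorem2p6 (R : realType)
  (l0 l1 f : (R -> R) -> R -> R)
  (l0_lin : linear_operator l0) (l0_cont : continuous_operator l0)
  (l0_pos : positive_operator l0)
  (l1_lin : linear_operator l1) (l1_cont : continuous_operator l1)
  (l1_pos : positive_operator l1)
  (f_cont : continuous_operator f) (f_Car : local_Caratheodory f)
  (t0 : R)
  (l0V : V l0) (l1V : V l1) (fV : V f)
  (l01P : Pplus (fun u t => l0 u t - l1 u t))
  (f0 : {ae leb, forall t : R, t <= t0 -> f (fun=> 0) t = 0})
  (kappa : R) (kappa_gt0 : 0 < kappa)
  (H1 : forall v : R -> R, C0 `[0, kappa] v ->
     {ae leb, forall t : R, t <= t0 -> 0 <= f v t})
  (q : R -> R -> R) (qK : Kloc t0 q)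
  (q_nd : forall t x y : R, t0 <= t -> 0 <= x -> x <= y -> q t x <= q t y)
  (q_lim : forall b : R, t0 < b ->
     (x^-1 * \int[leb]_(s in `[t0, b]) q s x) @[x --> +oo] --> (0 : R))
  (H2 : forall v : R -> R, C0 `[0, +oo[ v ->
     (forall t : R, t <= t0 -> v t <= kappa) ->
     {ae leb, forall t : R, t0 <= t ->
        0 <= f v t /\ f v t <= q t (fine (sup_norm v))}) :
  forall c : R, 0 <= c <= kappa ->
  exists u : R -> R,
    [/\ global_solution (fun w t => l0 w t - l1 w t + f w t) u,
        u t0 = c,
        forall t : R, t <= t0 -> 0 <= u t <= kappa
      & {ae leb, forall t : R, 0 <= derive1 u t}].
Proof.
move=> c c0k; have /andP[c0 ck] := c0k.
have [u [cu nd ge0 ut0 eq]] := limit_solution l0_lin l0_pos l1_lin l1_pos l0V l1V fV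
  l01P f_Car f0 kappa_gt0 H1 qK q_nd q_lim H2 c0k.
have uk t : t <= t0 -> u t <= kappa by move=> tt0; rewrite (le_trans (nd _ _ tt0))// ut0.
rewrite (trunc_id uk) in eq.
have Lu : Lloc (fun t => l0 u t - l1 u t + f u t).
  have := (rhs_mean_continuous l0V l1V fV t0 kappa).1 u cu; by rewrite (trunc_id uk).
have ACu := primitive_ACloc Lu eq.
have du := primitive_derive Lu eq.
exists u; split => //.
- by move=> t tt0; rewrite ge0 uk.
have Fu := rhs_positive_on_nondecreasing l0V l1V fV l01P kappa_gt0 H1 q_nd H2 ACu ge0 nd.
apply: filterS2 du Fu => t [_ ->]; by rewrite (trunc_id uk).
Qed.
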